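(* For all integers $k\ge 3$ and $n\ge 1$ with $(k,n)\neq(3,1)$, the number $p_k(n)$ of $k$-coloured partitions satisfies the strict log-concavity inequality \[ p_k(n)^2>p_k(n-1)\,p_k(n+1). \]
   Context: For $k\in\mathbb{N}$, $p_k(n)$ denotes the number of $k$-coloured partitions of $n$ (partitions of $n$ in which each part is assigned one of $k$ colours), i.e. $\sum_{n\ge0}p_k(n)q^n=\prod_{m\ge1}(1-q^m)^{-k}$, with $p_k(0)=1$. *)

(* Defs.v *)
From mathcomp Require Import all_boot.

Set Implicit Arguments.
Unset Strict Implicit.
Unset Printing Implicit Defensive.

(* A k-coloured partition of n is a finite multiset of pairs (part, colour)
   whose parts are positive and sum to n.  It is encoded by its multiplicity
   function: [m (i, c)] is the number of occurrences of the part [i.+1] in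
   colour [c].  Parts and multiplicities are at most n, so the ranges
   ['I_n] (for [i]) and ['I_n.+1] (for multiplicities) lose nothing. *)
Definition colored_partitions (k n : nat) :
    {set {ffun 'I_n * 'I_k -> 'I_n.+1}} :=
  [set m : {ffun 'I_n * 'I_k -> 'I_n.+1} |
     \sum_(ic : 'I_n * 'I_k) ic.1.+1 * m ic == n].

Definition nb_colored_partitions (k n : nat) : nat :=
  #|colored_partitions k n|.

(* Main.v *)
Require Import Defs.
From Stdlib Require Reals Lra Lia Psatz ZArith NArith List.
From Coquelicot Require Coquelicot.

(** Write [p_k] for the sequence of numbers of [k]-coloured partitions.

    Since [p_(k+l)] is the convolution of [p_k] and [p_l], and since the
    convolution of two positive log-concave sequences is strictly log-concave
    (its [2 x 2] minors are sums of products of minors, by the Binet-Cauchy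
    formula, and one of these products is positive), it suffices to treat
    [k = 3, 4, 5].

    For these [k] and [k n > 2160], let [b > 0] and [P_j = p_k(j) e^(-jb)].
    As [P_(n-1) P_(n+1)] is at most the square of the mean of [P_(n-1)] and
    [P_(n+1)], it suffices that [P_(n-1) + P_(n+1) < 2 P_n], which by Fourier
    inversion says that the integral over [[0, pi]] of
    [Re (F(t) e^(-int)) (1 - cos t)] is positive, where [F] is the
    characteristic function of a sum of independent multiples of geometric
    variables, [P(G = i)] being proportional to [e^(-mbi)] for the part [m].
    The parameter [b] is chosen such that the mean of this sum is [n].  Near [0]
    the phase of [F(t) e^(-int)] is then controlled by the third cumulant and
    its modulus by the variance; further away the modulus is exponentially
    small in [k / b].  The remaining cases [k n <= 2160] are computed. *)

Module Analytic.

Import Reals Lra Lia Psatz ZArith List Coquelicot.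
Import ListNotations.
Local Open Scope R_scope.

(** * The Fourier factor of one part *)

(** The obstacle is that the asymptotic estimate has to hold so early that the remaining cases can
    be computed, so every bound carries an explicit constant. The size of [n] acts mainly through
    [r ^ 2 = k / b]: with the unit [s = b / r] and [u = t / s], the modulus near 0 is governed by
    [u] alone, while the phase is at most [25 / 12 * u ^ 3 / r]; it turns out that [r >= 6] is
    enough. As the mean is at most [5 / 3 * k / b ^ 2], the saddle point has [k / b >= 36] once
    [k n > 5 / 3 * 36 ^ 2 = 2160]. Three colour numbers suffice because [k >= 6] splits as
    [3 + (k - 3)]. One or two colours cannot serve as a summand, since [p_1] and [p_2] are not
    log-concave at 1; [p_3] just can, as [3 ^ 2 = 1 * 9] there. Parts are cut off at some [M >= n],
    so that [F] is a finite product, handled through its real modulus and argument. *)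

Lemma nondecreasing_of_derive (f f' : R -> R) (a b : R) :
  a <= b ->
  (forall x, a <= x <= b -> is_derive f x (f' x)) ->
  (forall x, a <= x <= b -> 0 <= f' x) -> f a <= f b.
Proof.
intros hab hd hp.
destruct (MVT_gen f a b f') as [c [hc e]].
- intros x; rewrite Rmin_left, Rmax_right by lra; intros; apply hd; lra.
- intros x; rewrite Rmin_left, Rmax_right by lra; intros.
  apply derivable_continuous_pt; exists (f' x).
  apply is_derive_Reals, hd; lra.
- rewrite Rmin_left, Rmax_right in hc by lra.
  generalize (hp c hc); nra.
Qed.

Lemma one_sub_cos_le (x : R) : 1 - cos x <= x ^ 2 / 2.
Proof.
assert (H : forall y, 0 <= y -> 1 - cos y <= y ^ 2 / 2).
{ intros y hy.
  enough (0 ^ 2 / 2 - 1 + cos 0 <= y ^ 2 / 2 - 1 + cos y) by (rewrite cos_0 in *; lra).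
  apply (nondecreasing_of_derive (fun y => y ^ 2 / 2 - 1 + cos y) (fun y => y - sin y)); auto.
  - intros z _; auto_derive; auto; lra.
  - intros z hz; destruct (Req_dec z 0) as [->|]; [rewrite sin_0; lra|].
    generalize (sin_lt_x z); lra. }
destruct (Rle_lt_dec 0 x); auto.
rewrite <- cos_neg; replace (x ^ 2) with ((- x) ^ 2) by ring; apply H; lra.
Qed.

Lemma one_sub_cos_ge (x : R) : 0 <= x -> x ^ 2 / 2 - x ^ 4 / 24 <= 1 - cos x.
Proof.
assert (S : forall y, 0 <= y -> y - y ^ 3 / 6 <= sin y).
{ intros y hy.
  enough (sin 0 - 0 + 0 ^ 3 / 6 <= sin y - y + y ^ 3 / 6) by (rewrite sin_0 in *; lra).
  apply (nondecreasing_of_derive (fun y => sin y - y + y ^ 3 / 6)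
    (fun y => cos y - 1 + y ^ 2 / 2)); auto.
  - intros z _; auto_derive; auto; lra.
  - intros z _; generalize (one_sub_cos_le z); lra. }
intros hx.
enough (1 - cos 0 - 0 ^ 2 / 2 + 0 ^ 4 / 24 <= 1 - cos x - x ^ 2 / 2 + x ^ 4 / 24)
  by (rewrite cos_0 in *; lra).
apply (nondecreasing_of_derive (fun x => 1 - cos x - x ^ 2 / 2 + x ^ 4 / 24)
  (fun y => sin y - y + y ^ 3 / 6)); auto.
- intros z _; auto_derive; auto; lra.
- intros z hz; generalize (S z); lra.
Qed.

Lemma exp_le (x y : R) : x <= y -> exp x <= exp y.
Proof. intros [h| ->]; [left; apply exp_increasing, h|lra]. Qed.

Definition nsq (q x : R) : R := 1 - 2 * q * cos x + q ^ 2.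

Lemma nsq_alt (q x : R) : nsq q x = (1 - q) ^ 2 + 2 * q * (1 - cos x).
Proof. unfold nsq; ring. Qed.

Lemma nsq_ge (q x : R) : 0 <= q -> (1 - q) ^ 2 <= nsq q x.
Proof. rewrite nsq_alt; generalize (COS_bound x); nra. Qed.

Lemma nsq_gt0 (q x : R) : 0 <= q < 1 -> 0 < nsq q x.
Proof. intros h; generalize (nsq_ge q x); nra. Qed.

(** Modulus and argument of [(1 - q) / (1 - q e^{ix})], the characteristic function of a geometric
    variable. For [q < 1] the denominator has positive real part, so [atan] gives a smooth
    argument. *)
Definition fmod (q x : R) : R := (1 - q) / sqrt (nsq q x).
Definition farg (q x : R) : R := atan (q * sin x / (1 - q * cos x)).

Lemma exp_half_sq (a : R) : exp (a / 2) ^ 2 = exp a.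
Proof. rewrite <- Rsqr_pow2; unfold Rsqr; rewrite <- exp_plus; f_equal; field. Qed.

Lemma fmod_sq (q x : R) : 0 <= q < 1 -> fmod q x ^ 2 = (1 - q) ^ 2 / nsq q x.
Proof.
intros h; unfold fmod; generalize (nsq_gt0 q x h); intros hD.
unfold Rdiv; rewrite Rpow_mult_distr, pow_inv, pow2_sqrt; lra.
Qed.

Lemma fmod_gt0 (q x : R) : 0 <= q < 1 -> 0 < fmod q x.
Proof.
intros h; apply Rdiv_lt_0_compat; [lra|]; apply sqrt_lt_R0, nsq_gt0; auto.
Qed.

(** [q / (1 - q) ^ 2] is the variance. After squaring, this is [1 + y <= e^y] combined with
    [1 - cos x <= x ^ 2 / 2]. *)
Lemma fmod_ge (q x : R) : 0 <= q < 1 ->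
  exp (- (x ^ 2 / 2 * (q / (1 - q) ^ 2))) <= fmod q x.
Proof.
intros h; set (y := q / (1 - q) ^ 2).
assert (hD := nsq_gt0 q x h); assert (hf := fmod_gt0 q x h).
apply Rsqr_incr_0_var; [|lra]; rewrite !Rsqr_pow2.
replace (- (x ^ 2 / 2 * y)) with (- (x ^ 2 * y) / 2) by field.
rewrite exp_half_sq, fmod_sq by auto.
rewrite exp_Ropp; apply (Rmult_le_reg_r (exp (x ^ 2 * y))); [apply exp_pos|].
rewrite Rinv_l by (generalize (exp_pos (x ^ 2 * y)); lra).
apply (Rmult_le_reg_r (nsq q x)); auto.
replace ((1 - q) ^ 2 / nsq q x * exp (x ^ 2 * y) * nsq q x)
  with ((1 - q) ^ 2 * exp (x ^ 2 * y)) by (field; lra).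
assert (he := exp_ineq1_le (x ^ 2 * y)).
assert (hq2 : 0 < (1 - q) ^ 2) by nra.
assert (hy : (1 - q) ^ 2 * y = q) by (unfold y; field; lra).
rewrite nsq_alt; generalize (one_sub_cos_le x); intros.
apply Rle_trans with ((1 - q) ^ 2 * (1 + x ^ 2 * y)).
- replace ((1 - q) ^ 2 * (1 + x ^ 2 * y)) with ((1 - q) ^ 2 + x ^ 2 * ((1 - q) ^ 2 * y)) by ring.
  rewrite hy; nra.
- apply Rmult_le_compat_l; lra.
Qed.

(* The exponent consists of the first two terms of the series
   [ln (1 - q) - ln |1 - q e^{ix}| = - sum_j q^j (1 - cos (j x)) / j]. *)
Lemma fmod_le (q x : R) : 0 <= q < 1 ->
  fmod q x <= exp (- (q * (1 - cos x) + q ^ 2 * (1 - cos (2 * x)) / 2)).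
Proof.
intros h.
assert (hc := COS_bound x); set (c := cos x) in *.
assert (hc2 : 1 - cos (2 * x) = 2 * (1 - c ^ 2)) by (rewrite cos_2a_cos; unfold c; ring).
assert (K : 0 <= ln (nsq q x) - 2 * ln (1 - q)
               - 2 * (q * (1 - c) + q ^ 2 * (1 - c ^ 2))).
{ set (phi := fun p => ln (1 - 2 * p * c + p ^ 2) - 2 * ln (1 - p)
               - 2 * (p * (1 - c) + p ^ 2 * (1 - c ^ 2))).
  assert (h0 : phi 0 = 0).
  { unfold phi; replace (1 - 2 * 0 * c + 0 ^ 2) with 1 by ring.
    replace (1 - 0) with 1 by ring; rewrite ln_1; ring. }
  change (0 <= phi q); rewrite <- h0.
  apply (nondecreasing_of_derive phi (fun p => (2 * p - 2 * c) / (1 - 2 * p * c + p ^ 2)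
        + 2 / (1 - p) - 2 * (1 - c + 2 * p * (1 - c ^ 2)))); [lra| |].
  - intros p hp; assert (0 < 1 - 2 * p * c + p ^ 2) by nra.
    unfold phi; auto_derive; [split; lra|]; field; split; lra.
  - intros p hp; assert (hD : 0 < 1 - 2 * p * c + p ^ 2) by nra.
    replace ((2 * p - 2 * c) / (1 - 2 * p * c + p ^ 2)
        + 2 / (1 - p) - 2 * (1 - c + 2 * p * (1 - c ^ 2)))
      with (2 * (1 - c) * ((1 + p) - (1 - p) * (1 - 2 * p * c + p ^ 2) * (1 + 2 * p * (1 + c)))
            / ((1 - p) * (1 - 2 * p * c + p ^ 2))) by (field; lra).
    apply Rdiv_le_0_compat; [|nra].
    apply Rmult_le_pos; [lra|].
    (* In [r = 2 p c] the left side is a concave quadratic; the right side is its maximum, at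
       [r = (p ^ 2 - 2 p) / 2]. *)
    assert (hr : (1 - 2 * p * c + p ^ 2) * (1 + 2 * p * (1 + c)) <=
            1 + 2 * p + 2 * p ^ 2 + p ^ 3 + p ^ 4 / 4).
    { replace (2 * p * (1 + c)) with (2 * p + 2 * p * c) by ring; set (r := 2 * p * c).
      generalize (pow2_ge_0 (r - (p ^ 2 - 2 * p) / 2)); nra. }
    assert ((1 - p) * ((1 - 2 * p * c + p ^ 2) * (1 + 2 * p * (1 + c))) <=
            (1 - p) * (1 + 2 * p + 2 * p ^ 2 + p ^ 3 + p ^ 4 / 4))
      by (apply Rmult_le_compat_l; lra).
    assert (0 <= p ^ 3) by (apply pow_le; lra).
    assert (0 <= p ^ 4) by (apply pow_le; lra).
    assert (0 <= p ^ 5) by (apply pow_le; lra).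
    assert ((1 - p) * (1 + 2 * p + 2 * p ^ 2 + p ^ 3 + p ^ 4 / 4) =
       1 + p - p ^ 3 - 3 / 4 * p ^ 4 - p ^ 5 / 4) by field.
    rewrite Rmult_assoc; rewrite H3 in H; lra. }
assert (hD := nsq_gt0 q x h); assert (hf := fmod_gt0 q x h).
rewrite hc2.
set (A := q * (1 - c) + q ^ 2 * (1 - c ^ 2)) in K.
replace (q * (1 - c) + q ^ 2 * (2 * (1 - c ^ 2)) / 2) with A by (unfold A; field).
rewrite <- (exp_ln (fmod q x)) by auto.
apply exp_le.
unfold fmod; rewrite ln_div by (try lra; apply sqrt_lt_R0; auto).
rewrite <- Rpower_sqrt by auto; unfold Rpower; rewrite ln_exp; lra.
Qed.

Lemma is_derive_farg (q x : R) : 0 <= q < 1 ->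
  is_derive (farg q) x ((q * cos x - q ^ 2) / nsq q x).
Proof.
intros h; assert (hD := nsq_gt0 q x h); assert (hc := COS_bound x).
assert (0 < 1 - q * cos x) by nra.
unfold farg; auto_derive; [lra|].
assert (hs := sin2_cos2 x); unfold Rsqr in hs.
assert (e : 1 + q * sin x / (1 - q * cos x) * (q * sin x / (1 - q * cos x)) =
            nsq q x / (1 - q * cos x) ^ 2).
{ replace (nsq q x) with (1 - 2 * q * cos x + q ^ 2 * (sin x * sin x + cos x * cos x))
    by (rewrite hs; unfold nsq; ring).
  field; lra. }
replace (1 + q * sin x * / (1 + - (q * cos x)) * (q * sin x * / (1 + - (q * cos x)) * 1))
  with (nsq q x / (1 - q * cos x) ^ 2)
  by (rewrite <- e; unfold Rdiv; rewrite Rmult_1_r; reflexivity).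
replace (q * cos x - q ^ 2) with (q * cos x - q ^ 2 * (sin x * sin x + cos x * cos x))
  by (rewrite hs; ring).
field; split; lra.
Qed.

(** The factors [q / (1 - q)] and [q (1 + q) / (1 - q) ^ 3] are the first and third cumulants. The
    derivative [d] of the difference is a multiple of [1 - cos], hence lies between 0 and its
    quadratic bound. *)
Lemma farg_bounds (q x : R) : 0 <= q < 1 -> 0 <= x ->
  0 <= x * (q / (1 - q)) - farg q x <= x ^ 3 / 6 * (q * (1 + q) / (1 - q) ^ 3).
Proof.
intros h hx.
assert (h0 : farg q 0 = 0)
  by (unfold farg; rewrite sin_0, Rmult_0_r; unfold Rdiv; rewrite Rmult_0_l; apply atan_0).
set (k := q * (1 + q) / (1 - q) ^ 3).
set (d := fun y => q / (1 - q) - (q * cos y - q ^ 2) / nsq q y).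
assert (hd : forall y, d y = q * (1 + q) * (1 - cos y) / ((1 - q) * nsq q y)).
{ intros y; assert (hD := nsq_gt0 q y h); unfold d, nsq in *; field; lra. }
assert (hd0 : forall y, 0 <= d y).
{ intros y; rewrite hd; assert (hD := nsq_gt0 q y h); assert (hc := COS_bound y).
  apply Rdiv_le_0_compat; [|nra]; apply Rmult_le_pos; nra. }
assert (hd1 : forall y, d y <= y ^ 2 / 2 * k).
{ intros y; rewrite hd; assert (hD := nsq_gt0 q y h); assert (hc := one_sub_cos_le y).
  assert (hg := nsq_ge q y (proj1 h)).
  replace (y ^ 2 / 2 * k) with (q * (1 + q) * (y ^ 2 / 2) / ((1 - q) * (1 - q) ^ 2))
    by (unfold k; field; lra).
  assert (0 < (1 - q) ^ 2) by nra; assert (0 <= q * (1 + q)) by nra.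
  assert (0 <= 1 - cos y) by (generalize (COS_bound y); lra).
  apply Rmult_le_compat; try nra.
  - left; apply Rinv_0_lt_compat; nra.
  - apply Rinv_le_contravar; nra. }
split.
- apply Rle_trans with (0 * (q / (1 - q)) - farg q 0); [rewrite h0; lra|].
  apply (nondecreasing_of_derive (fun y => y * (q / (1 - q)) - farg q y) d); auto.
  intros y _; unfold d.
  apply (is_derive_minus (fun y => y * (q / (1 - q))) (farg q)); [|apply is_derive_farg, h].
  auto_derive; auto; ring.
- enough (0 ^ 3 / 6 * k - (0 * (q / (1 - q)) - farg q 0) <=
          x ^ 3 / 6 * k - (x * (q / (1 - q)) - farg q x)) by (rewrite h0 in *; lra).
  apply (nondecreasing_of_derive
    (fun y => y ^ 3 / 6 * k - (y * (q / (1 - q)) - farg q y)) (fun y => y ^ 2 / 2 * k - d y)); auto.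
  2: { intros y _; generalize (hd1 y); lra. }
  intros y _; unfold d.
  apply (is_derive_minus (fun y => y ^ 3 / 6 * k) (fun y => y * (q / (1 - q)) - farg q y)).
  + auto_derive; auto; field.
  + apply (is_derive_minus (fun y => y * (q / (1 - q))) (farg q)); [|apply is_derive_farg, h].
    auto_derive; auto; ring.
Qed.

Lemma ex_derive_fmod (q x : R) : 0 <= q < 1 -> ex_derive (fmod q) x.
Proof.
intros h; assert (hD := nsq_gt0 q x h); unfold fmod, nsq in *.
auto_derive; split; [lra|]; split; auto.
apply Rgt_not_eq, sqrt_lt_R0; lra.
Qed.

Lemma fmod_le1 (q x : R) : 0 <= q < 1 -> fmod q x <= 1.
Proof.
intros h; apply Rle_trans with (1 := fmod_le q x h).
apply Rle_trans with (exp 0); [apply exp_le|rewrite exp_0; lra].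
assert (h1 := COS_bound x); assert (h2 := COS_bound (2 * x)).
assert (0 <= q * (1 - cos x)) by (apply Rmult_le_pos; lra).
assert (0 <= q ^ 2 * (1 - cos (2 * x))) by (apply Rmult_le_pos; [apply pow2_ge_0|lra]).
lra.
Qed.

(* Multiplication by [(1 - q e^{ix}) / (1 - q)] undoes one Fourier factor. *)
Lemma fourier_factor (q x a : R) : 0 <= q < 1 ->
  fmod q x * (cos (farg q x + a) - q * cos (farg q x + a + x)) = (1 - q) * cos a.
Proof.
intros h; assert (hD := nsq_gt0 q x h); assert (hc := COS_bound x).
assert (hs := sin2_cos2 x); unfold Rsqr in hs.
set (c := 1 - q * cos x); set (s := q * sin x).
assert (c0 : 0 < c) by (unfold c; nra).
assert (e : nsq q x = c ^ 2 + s ^ 2).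
{ unfold c, s, nsq; replace (q ^ 2) with (q ^ 2 * (sin x * sin x + cos x * cos x)) at 1
    by (rewrite hs; ring); ring. }
assert (r0 : 0 < sqrt (nsq q x)) by (apply sqrt_lt_R0; auto).
assert (rr : sqrt (nsq q x) ^ 2 = nsq q x) by (apply pow2_sqrt; lra).
set (r := sqrt (nsq q x)) in *.
assert (es : sqrt (1 + (s / c)²) = r / c).
{ unfold r; rewrite <- (sqrt_pow2 c) at 2 by lra.
  rewrite <- sqrt_div_alt by (apply pow_lt; auto).
  f_equal; rewrite e; unfold Rsqr; field; lra. }
assert (ec : cos (farg q x) = c / r).
{ unfold farg; fold c s; rewrite cos_atan, es; field; split; lra. }
assert (esn : sin (farg q x) = s / r).
{ unfold farg; fold c s; rewrite sin_atan, es; field; split; lra. }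
set (al := farg q x) in *.
replace (cos (al + a) - q * cos (al + a + x)) with (c * cos (al + a) + s * sin (al + a))
  by (rewrite (cos_plus (al + a) x); unfold c, s; ring).
rewrite cos_plus, sin_plus, ec, esn; unfold fmod; fold r.
replace ((1 - q) / r * (c * (c / r * cos a - s / r * sin a) + s * (s / r * cos a + c / r * sin a)))
  with ((1 - q) * cos a * ((c ^ 2 + s ^ 2) / r ^ 2)) by (field; lra).
rewrite rr, e; field; rewrite <- e; lra.
Qed.

(** * Fourier coefficients *)

Definition wt (b : R) (m : nat) : R := exp (- (INR m * b)).

Lemma wt_bounds (b : R) (m : nat) : 0 < b -> (1 <= m)%nat -> 0 <= wt b m < 1.
Proof.
intros hb hm; unfold wt; split; [left; apply exp_pos|].
rewrite <- exp_0; apply exp_increasing.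
apply le_INR in hm; simpl in hm; nra.
Qed.

(** [ms] lists the parts with repetition, one copy per colour. Summing the [atan]s yields a
    continuous argument that may leave [(-PI, PI]] and can be compared with a linear function of
    [t]. The index of [fourier] is in [Z] because the recursion on it runs below 0. *)
Definition chmod (b : R) (ms : list nat) (t : R) : R :=
  fold_right (fun m r => fmod (wt b m) (INR m * t) * r) 1 ms.
Definition charg (b : R) (ms : list nat) (t : R) : R :=
  fold_right (fun m r => farg (wt b m) (INR m * t) + r) 0 ms.
Definition fourier (b : R) (ms : list nat) (j : Z) (t : R) : R :=
  chmod b ms t * cos (charg b ms t - IZR j * t).

Definition pos_parts (ms : list nat) : Prop := List.Forall (fun m => (1 <= m)%nat) ms.

Lemma ex_derive_chmod (b : R) (ms : list nat) (t : R) :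
  0 < b -> pos_parts ms -> ex_derive (chmod b ms) t.
Proof.
intros hb; induction 1 as [|m ms hm _ IH]; [apply ex_derive_const|].
apply (ex_derive_mult (fun t => fmod (wt b m) (INR m * t)) (chmod b ms)); auto.
apply (ex_derive_comp (fmod (wt b m)) (fun t => INR m * t)).
- apply ex_derive_fmod, wt_bounds; auto.
- auto_derive; auto.
Qed.

Lemma ex_derive_charg (b : R) (ms : list nat) (t : R) :
  0 < b -> pos_parts ms -> ex_derive (charg b ms) t.
Proof.
intros hb; induction 1 as [|m ms hm _ IH]; [apply ex_derive_const|].
apply (ex_derive_plus (fun t => farg (wt b m) (INR m * t)) (charg b ms)); auto.
apply (ex_derive_comp (farg (wt b m)) (fun t => INR m * t)).
- eexists; apply is_derive_farg, wt_bounds; auto.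
- auto_derive; auto.
Qed.

Lemma continuous_fourier (b : R) (ms : list nat) (j : Z) (t : R) :
  0 < b -> pos_parts ms -> continuous (fourier b ms j) t.
Proof.
intros hb hms; apply (ex_derive_continuous (V := R_NormedModule)).
apply (ex_derive_mult (chmod b ms)); [apply ex_derive_chmod; auto|].
apply (ex_derive_comp cos); [auto_derive; auto|].
apply (ex_derive_minus (charg b ms)); [apply ex_derive_charg; auto|auto_derive; auto].
Qed.

Lemma ex_RInt_fourier (b : R) (ms : list nat) (j : Z) (x y : R) :
  0 < b -> pos_parts ms -> ex_RInt (fourier b ms j) x y.
Proof.
intros hb hms; apply (@ex_RInt_continuous R_CompleteNormedModule).
intros; apply continuous_fourier; auto.
Qed.

Lemma chmod_bounds (b : R) (ms : list nat) (t : R) :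
  0 < b -> pos_parts ms -> 0 < chmod b ms t <= 1.
Proof.
intros hb; induction 1 as [|m ms hm _ IH]; simpl; [lra|].
assert (hw := wt_bounds b m hb hm).
generalize (fmod_gt0 _ (INR m * t) hw) (fmod_le1 _ (INR m * t) hw); nra.
Qed.

Definition fcoef (b : R) (ms : list nat) (j : Z) : R := RInt (fourier b ms j) 0 PI.

(** Multiplication by [e^{imt}] lowers the index by [m], so [fourier_factor] integrates to a
    weighted form of the counting recursion [cf_cons]. *)
Lemma fcoef_rec (b : R) (m : nat) (ms : list nat) (j : Z) :
  0 < b -> (1 <= m)%nat -> pos_parts ms ->
  fcoef b (m :: ms) j =
  wt b m * fcoef b (m :: ms) (j - Z.of_nat m) + (1 - wt b m) * fcoef b ms j.
Proof.
intros hb hm hms; assert (hms' : pos_parts (m :: ms)) by (constructor; auto).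
unfold fcoef.
rewrite <- !(RInt_scal (V := R_CompleteNormedModule)) by (apply ex_RInt_fourier; auto).
rewrite <- (RInt_plus (V := R_CompleteNormedModule))
  by (apply (ex_RInt_scal (V := R_CompleteNormedModule)), ex_RInt_fourier; auto).
apply RInt_ext; intros t _.
change (fourier b (m :: ms) j t =
  wt b m * fourier b (m :: ms) (j - Z.of_nat m) t + (1 - wt b m) * fourier b ms j t).
assert (hf := fourier_factor (wt b m) (INR m * t) (charg b ms t - IZR j * t)
                (wt_bounds b m hb hm)).
unfold fourier; simpl.
rewrite minus_IZR, <- INR_IZR_INZ.
replace (farg (wt b m) (INR m * t) + charg b ms t - (IZR j - INR m) * t) with
  (farg (wt b m) (INR m * t) + (charg b ms t - IZR j * t) + INR m * t) by ring.
replace (farg (wt b m) (INR m * t) + charg b ms t - IZR j * t) with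
  (farg (wt b m) (INR m * t) + (charg b ms t - IZR j * t)) by ring.
set (w := wt b m) in *; set (c2 := cos (_ + _ + _)) in *; set (c1 := cos (farg _ _ + _)) in *.
replace ((1 - w) * (chmod b ms t * cos (charg b ms t - IZR j * t))) with
  (chmod b ms t * ((1 - w) * cos (charg b ms t - IZR j * t))) by ring.
rewrite <- hf; ring.
Qed.

Lemma fcoef_abs_le (b : R) (ms : list nat) (j : Z) :
  0 < b -> pos_parts ms -> Rabs (fcoef b ms j) <= PI.
Proof.
intros hb hms; replace PI with ((PI - 0) * 1) by ring.
unfold fcoef; rewrite Rminus_0_r, Rmult_1_r.
replace PI with ((PI - 0) * 1) at 2 by ring.
apply (abs_RInt_le_const (fourier b ms j) 0 PI 1).
- left; apply PI_RGT_0.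
- apply ex_RInt_fourier; auto.
- intros t _; unfold fourier; rewrite Rabs_mult.
  destruct (chmod_bounds b ms t hb hms).
  rewrite (Rabs_pos_eq (chmod b ms t)) by lra.
  assert (Rabs (cos (charg b ms t - IZR j * t)) <= 1) by (apply Rabs_le, COS_bound).
  generalize (Rabs_pos (cos (charg b ms t - IZR j * t))); nra.
Qed.

Lemma fcoef_nil (b : R) (j : Z) : fcoef b [] j = if Z.eqb j 0 then PI else 0.
Proof.
unfold fcoef; rewrite (RInt_ext _ (fun t => cos (IZR j * t))).
2: { intros t _; unfold fourier; simpl; rewrite Rmult_1_l, <- (cos_neg (IZR j * t)).
     f_equal; ring. }
destruct (Z.eqb_spec j 0) as [->|hj].
- rewrite (RInt_ext _ (fun _ => 1)) by (intros; rewrite Rmult_0_l; apply cos_0).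
  rewrite RInt_const; unfold scal; simpl; unfold mult; simpl; ring.
- assert (IZR j <> 0) by (apply not_0_IZR; auto).
  apply is_RInt_unique.
  replace 0 with (minus (sin (IZR j * PI) / IZR j) (sin (IZR j * 0) / IZR j)) at 2.
  + apply (is_RInt_derive (fun t => sin (IZR j * t) / IZR j)).
    * intros t _; auto_derive; auto; field; auto.
    * intros t _; apply (ex_derive_continuous (V := R_NormedModule)); auto_derive; auto.
  + rewrite (sin_eq_0_1 (IZR j * PI)) by (exists j; auto).
    rewrite Rmult_0_r, sin_0; unfold minus, plus, opp; simpl; field; auto.
Qed.

(** For negative indices the inhomogeneous term of [fcoef_rec] vanishes by induction. Iterating it
    [i] times leaves a factor [wt b m ^ i], while the coefficients stay bounded by [PI]. *)
Lemma fcoef_neg (b : R) (ms : list nat) (j : Z) :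
  0 < b -> pos_parts ms -> (j < 0)%Z -> fcoef b ms j = 0.
Proof.
intros hb hms; revert j; induction hms as [|m ms hm hms IH]; intros j hj.
{ rewrite fcoef_nil; destruct (Z.eqb_spec j 0); [lia|auto]. }
assert (hms' : pos_parts (m :: ms)) by (constructor; auto).
assert (hw := wt_bounds b m hb hm).
assert (E : forall i : nat, fcoef b (m :: ms) j =
  wt b m ^ i * fcoef b (m :: ms) (j - Z.of_nat i * Z.of_nat m)).
{ induction i as [|i IHi].
  - simpl; rewrite Rmult_1_l; f_equal; lia.
  - rewrite IHi, (fcoef_rec b m ms (j - Z.of_nat i * Z.of_nat m)), IH by (auto; nia).
    replace (j - Z.of_nat i * Z.of_nat m - Z.of_nat m)%Z
      with (j - Z.of_nat (S i) * Z.of_nat m)%Z by nia.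
    simpl; ring. }
assert (B : forall i : nat, Rabs (fcoef b (m :: ms) j) <= wt b m ^ i * PI).
{ intros i; rewrite (E i), Rabs_mult, Rabs_pos_eq by (apply pow_le; lra).
  apply Rmult_le_compat_l; [apply pow_le; lra|apply fcoef_abs_le; auto]. }
assert (L : Rbar_le (Rabs (fcoef b (m :: ms) j)) (0 * PI)).
{ apply (is_lim_seq_le (fun _ => Rabs (fcoef b (m :: ms) j)) (fun i => wt b m ^ i * PI)); auto.
  - apply is_lim_seq_const.
  - apply (is_lim_seq_scal_r _ PI 0), is_lim_seq_geom; rewrite Rabs_pos_eq; lra. }
simpl in L; rewrite Rmult_0_l in L.
generalize (Rabs_pos (fcoef b (m :: ms) j)); intros.
destruct (Req_dec (fcoef b (m :: ms) j) 0) as [|n]; auto.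
apply Rabs_pos_lt in n; lra.
Qed.

Section Counting.

Variable cf : list nat -> nat -> nat.
Hypothesis cf_nil : forall j, cf [] j = if Nat.eqb j 0 then 1%nat else 0%nat.
Hypothesis cf_cons : forall m ms j, (1 <= m)%nat ->
  cf (m :: ms) j = (cf ms j + if Nat.leb m j then cf (m :: ms) (j - m) else 0)%nat.

Definition norm_const (b : R) (ms : list nat) : R :=
  fold_right (fun m r => (1 - wt b m) * r) 1 ms.

Lemma norm_const_gt0 (b : R) (ms : list nat) :
  0 < b -> pos_parts ms -> 0 < norm_const b ms.
Proof.
intros hb; induction 1 as [|m ms hm _ IH]; simpl; [lra|].
generalize (wt_bounds b m hb hm); nra.
Qed.

(** Fourier inversion without any infinite series: both sides satisfy the same recursion with the
    same initial values. *)
Lemma fcoef_eq (b : R) (ms : list nat) (j : nat) : 0 < b -> pos_parts ms ->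
  fcoef b ms (Z.of_nat j) = PI * norm_const b ms * (INR (cf ms j) * exp (- (INR j * b))).
Proof.
intros hb hms; revert j; induction hms as [|m ms hm hms IH]; intros j.
{ rewrite fcoef_nil, cf_nil; simpl; destruct j; simpl.
  - rewrite Rmult_0_l, Ropp_0, exp_0; ring.
  - ring. }
assert (hms' : pos_parts (m :: ms)) by (constructor; auto).
induction j as [j IHj] using lt_wf_ind.
rewrite fcoef_rec, IH, cf_cons by auto; simpl norm_const.
destruct (Nat.leb_spec m j).
- rewrite <- Nat2Z.inj_sub, IHj by lia; simpl norm_const.
  rewrite plus_INR.
  replace (exp (- (INR j * b))) with (wt b m * exp (- (INR (j - m) * b))).
  + ring.
  + unfold wt; rewrite <- exp_plus, minus_INR by lia; f_equal; ring.
- rewrite fcoef_neg by (auto; lia); rewrite Nat.add_0_r; ring.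
Qed.

(* AM-GM on the outer terms: midpoint concavity of [j |-> cf j * e^{-jb}] at
   [n], for a single [b], already gives log-concavity of [cf] at [n]. *)
Lemma log_concave_of_integral (b : R) (ms : list nat) (n : nat) :
  0 < b -> pos_parts ms -> (1 <= n)%nat ->
  0 < RInt (fun t => fourier b ms (Z.of_nat n) t * (1 - cos t)) 0 PI ->
  (cf ms (n - 1) * cf ms (n + 1) < cf ms n * cf ms n)%nat.
Proof.
intros hb hms hn hI.
assert (E : 2 * RInt (fun t => fourier b ms (Z.of_nat n) t * (1 - cos t)) 0 PI =
  2 * fcoef b ms (Z.of_nat n) - (fcoef b ms (Z.of_nat (n - 1)) + fcoef b ms (Z.of_nat (n + 1)))).
{ unfold fcoef.
  rewrite <- (RInt_plus (V := R_CompleteNormedModule)) by (apply ex_RInt_fourier; auto).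
  assert (X : ex_RInt (fun t => fourier b ms (Z.of_nat n) t * (1 - cos t)) 0 PI).
  { apply (@ex_RInt_continuous R_CompleteNormedModule); intros t _.
    apply (continuous_mult (K := R_AbsRing) (fourier b ms (Z.of_nat n)));
      [apply continuous_fourier; auto|].
    apply (ex_derive_continuous (V := R_NormedModule)); auto_derive; auto. }
  set (g := fun t => fourier b ms (Z.of_nat n) t * (1 - cos t)) in *.
  set (f := fourier b ms (Z.of_nat n)).
  assert (F : ex_RInt f 0 PI) by (apply ex_RInt_fourier; auto).
  change (2 * RInt g 0 PI) with (scal 2 (RInt g 0 PI)).
  change (2 * RInt f 0 PI) with (scal 2 (RInt f 0 PI)).
  rewrite <- !(RInt_scal (V := R_CompleteNormedModule)) by auto.
  change (@RInt R_CompleteNormedModule (fun x => scal 2 (g x)) 0 PI =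
    minus (@RInt R_CompleteNormedModule (fun x => scal 2 (f x)) 0 PI)
     (@RInt R_CompleteNormedModule (fun x => plus (fourier b ms (Z.of_nat (n - 1)) x)
        (fourier b ms (Z.of_nat (n + 1)) x)) 0 PI)).
  rewrite <- (RInt_minus (V := R_CompleteNormedModule)).
  - apply RInt_ext; intros t _; unfold g, f, minus, plus, opp, scal; simpl; unfold mult; simpl.
    unfold fourier.
    rewrite <- !INR_IZR_INZ, minus_INR, plus_INR by lia; simpl INR.
    set (a := charg b ms t).
    replace (a - (INR n - 1) * t) with (a - INR n * t + t) by ring.
    replace (a - (INR n + 1) * t) with (a - INR n * t - t) by ring.
    rewrite (cos_plus _ t), (cos_minus _ t); ring.
  - apply (ex_RInt_scal (V := R_CompleteNormedModule)); auto.
  - apply (ex_RInt_plus (V := R_CompleteNormedModule)); apply ex_RInt_fourier; auto. }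
rewrite !fcoef_eq in E by auto.
set (K := PI * norm_const b ms) in E.
assert (hK : 0 < K) by (apply Rmult_lt_0_compat; [apply PI_RGT_0|apply norm_const_gt0; auto]).
set (x := exp (- (INR n * b))) in E; set (y := exp b).
assert (hx : 0 < x) by apply exp_pos; assert (hy : 0 < y) by apply exp_pos.
replace (exp (- (INR (n - 1) * b))) with (x * y) in E
  by (unfold x, y; rewrite <- exp_plus, minus_INR by auto; simpl; f_equal; ring).
replace (exp (- (INR (n + 1) * b))) with (x / y) in E
  by (unfold x, y, Rdiv; rewrite <- exp_Ropp, <- exp_plus, plus_INR; simpl; f_equal; ring).
set (u := INR (cf ms (n - 1))) in E; set (v := INR (cf ms (n + 1))) in E.
set (w := INR (cf ms n)) in E.
assert (hu : 0 <= u) by apply pos_INR; assert (hv : 0 <= v) by apply pos_INR.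
assert (H : u * y + v / y < 2 * w).
{ apply (Rmult_lt_reg_l (K * x)); [apply Rmult_lt_0_compat; auto|].
  replace (K * x * (u * y + v / y)) with (K * (u * (x * y)) + K * (v * (x / y)))
    by (field; lra).
  lra. }
assert (hvy : 0 <= v / y) by (apply Rdiv_le_0_compat; auto).
assert (huy : 0 <= u * y) by (apply Rmult_le_pos; lra).
assert (P : u * v = (u * y) * (v / y)) by (field; lra).
apply INR_lt; rewrite !mult_INR; fold u v w; rewrite P.
generalize (pow2_ge_0 (u * y - v / y)); nra.
Qed.

End Counting.

(** * Cumulant bounds *)

(** The quotient of the two polynomials is the Padé approximant of type (2, 2). The difference and
    its first two derivatives vanish at 0, and the third is [exp x * x ^ 2 / 12]. *)
Lemma exp_pade (x : R) : 0 <= x ->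
  1 + x / 2 + x ^ 2 / 12 <= exp x * (1 - x / 2 + x ^ 2 / 12).
Proof.
assert (H2 : forall y, 0 <= y -> 0 <= exp y * (1 / 6 - y / 6 + y ^ 2 / 12) - 1 / 6).
{ intros y hy.
  replace 0 with (exp 0 * (1 / 6 - 0 / 6 + 0 ^ 2 / 12) - 1 / 6) by (rewrite exp_0; field).
  apply (nondecreasing_of_derive (fun y => exp y * (1 / 6 - y / 6 + y ^ 2 / 12) - 1 / 6)
          (fun y => exp y * (y ^ 2 / 12))); auto.
  - intros z _; auto_derive; auto; field.
  - intros z _; apply Rmult_le_pos; [left; apply exp_pos|nra]. }
assert (H1 : forall y, 0 <= y -> 0 <= exp y * (1 / 2 - y / 3 + y ^ 2 / 12) - 1 / 2 - y / 6).
{ intros y hy.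
  replace 0 with (exp 0 * (1 / 2 - 0 / 3 + 0 ^ 2 / 12) - 1 / 2 - 0 / 6) by (rewrite exp_0; field).
  apply (nondecreasing_of_derive (fun y => exp y * (1 / 2 - y / 3 + y ^ 2 / 12) - 1 / 2 - y / 6)
          (fun y => exp y * (1 / 6 - y / 6 + y ^ 2 / 12) - 1 / 6)); auto.
  - intros z _; auto_derive; auto; field.
  - intros z hz; apply H2; lra. }
intros hx; enough (0 <= exp x * (1 - x / 2 + x ^ 2 / 12) - (1 + x / 2 + x ^ 2 / 12)) by lra.
replace 0 with (exp 0 * (1 - 0 / 2 + 0 ^ 2 / 12) - (1 + 0 / 2 + 0 ^ 2 / 12))
  by (rewrite exp_0; field).
apply (nondecreasing_of_derive (fun x => exp x * (1 - x / 2 + x ^ 2 / 12) - (1 + x / 2 + x ^ 2 / 12))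
        (fun y => exp y * (1 / 2 - y / 3 + y ^ 2 / 12) - 1 / 2 - y / 6)); auto.
- intros z _; auto_derive; auto; field.
- intros z hz; apply H1; lra.
Qed.

Lemma exp_opp_lt1 (x : R) : 0 < x -> 0 < exp (- x) < 1.
Proof.
intros hx; split; [apply exp_pos|rewrite <- exp_0; apply exp_increasing; lra].
Qed.

Lemma div_1_sub_exp_le (x : R) : 0 < x -> x / (1 - exp (- x)) <= 1 + x / 2 + x ^ 2 / 12.
Proof.
intros hx; assert (hq := exp_opp_lt1 x hx).
apply (Rmult_le_reg_r (1 - exp (- x))); [lra|].
replace (x / (1 - exp (- x)) * (1 - exp (- x))) with x by (field; lra).
assert (h := exp_pade x (Rlt_le _ _ hx)).
apply (Rmult_le_compat_l (exp (- x))) in h; [|lra].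
replace (exp (- x) * (exp x * (1 - x / 2 + x ^ 2 / 12))) with (1 - x / 2 + x ^ 2 / 12) in h
  by (rewrite <- Rmult_assoc, <- exp_plus, Rplus_opp_l, exp_0; ring).
lra.
Qed.

(** The right side is [coth (x / 2)]. *)
Lemma two_div_le (x : R) : 0 < x -> 2 / x <= (1 + exp (- x)) / (1 - exp (- x)).
Proof.
intros hx; assert (hq := exp_opp_lt1 x hx); set (q := exp (- x)) in *.
enough (0 <= x * (1 + q) - 2 * (1 - q)).
{ replace ((1 + q) / (1 - q)) with (2 / x + (x * (1 + q) - 2 * (1 - q)) / (x * (1 - q)))
    by (field; lra).
  assert (0 <= (x * (1 + q) - 2 * (1 - q)) / (x * (1 - q)))
    by (apply Rdiv_le_0_compat; [lra|nra]); lra. }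
assert (D : forall y, 0 <= y -> 0 <= 1 - (1 + y) * exp (- y)).
{ intros y hy.
  replace 0 with (1 - (1 + 0) * exp (- 0)) by (rewrite Ropp_0, exp_0; ring).
  apply (nondecreasing_of_derive (fun y => 1 - (1 + y) * exp (- y)) (fun y => y * exp (- y))); auto.
  - intros z _; auto_derive; auto; ring.
  - intros z hz; apply Rmult_le_pos; [lra|left; apply exp_pos]. }
unfold q; replace 0 with (0 * (1 + exp (- 0)) - 2 * (1 - exp (- 0))) by (rewrite Ropp_0, exp_0; ring).
apply (nondecreasing_of_derive (fun x => x * (1 + exp (- x)) - 2 * (1 - exp (- x)))
         (fun y => 1 - (1 + y) * exp (- y))); [lra| |].
- intros z _; auto_derive; auto; ring.
- intros z hz; apply D; lra.
Qed.

(** Fourth derivatives are compared: [exp x + exp (- x)] against [12 / 5]. The range contains both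
    [b] and [2 b] for [b <= 5 / 36]. *)
Lemma exp_add_exp_opp_le (x : R) : 0 <= x <= 3 / 10 -> exp x + exp (- x) - 2 <= x ^ 2 + x ^ 4 / 10.
Proof.
assert (E : forall y, 0 <= y <= 3 / 10 -> exp y + exp (- y) <= 12 / 5).
{ intros y hy.
  assert (h1 := exp_ineq1_le (- y)); assert (h2 := exp_ineq1_le y).
  assert (h3 : exp y * exp (- y) = 1) by (rewrite <- exp_plus, Rplus_opp_r; apply exp_0).
  nra. }
assert (H3 : forall y, 0 <= y <= 3 / 10 -> 0 <= 12 / 5 * y - (exp y - exp (- y))).
{ intros y hy.
  replace 0 with (12 / 5 * 0 - (exp 0 - exp (- 0))) by (rewrite Ropp_0, exp_0; ring).
  apply (nondecreasing_of_derive (fun y => 12 / 5 * y - (exp y - exp (- y)))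
     (fun y => 12 / 5 - (exp y + exp (- y)))); [lra| |].
  - intros z _; auto_derive; auto; ring.
  - intros z hz; generalize (E z); lra. }
assert (H2 : forall y, 0 <= y <= 3 / 10 -> 0 <= 2 + 6 / 5 * y ^ 2 - (exp y + exp (- y))).
{ intros y hy.
  replace 0 with (2 + 6 / 5 * 0 ^ 2 - (exp 0 + exp (- 0))) by (rewrite Ropp_0, exp_0; ring).
  apply (nondecreasing_of_derive (fun y => 2 + 6 / 5 * y ^ 2 - (exp y + exp (- y)))
     (fun y => 12 / 5 * y - (exp y - exp (- y)))); [lra| |].
  - intros z _; auto_derive; auto; field.
  - intros z hz; apply H3; lra. }
assert (H1 : forall y, 0 <= y <= 3 / 10 -> 0 <= 2 * y + 2 / 5 * y ^ 3 - (exp y - exp (- y))).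
{ intros y hy.
  replace 0 with (2 * 0 + 2 / 5 * 0 ^ 3 - (exp 0 - exp (- 0))) by (rewrite Ropp_0, exp_0; ring).
  apply (nondecreasing_of_derive (fun y => 2 * y + 2 / 5 * y ^ 3 - (exp y - exp (- y)))
     (fun y => 2 + 6 / 5 * y ^ 2 - (exp y + exp (- y)))); [lra| |].
  - intros z _; auto_derive; auto; field.
  - intros z hz; apply H2; lra. }
intros hx; enough (0 <= x ^ 2 + x ^ 4 / 10 - (exp x + exp (- x) - 2)) by lra.
replace 0 with (0 ^ 2 + 0 ^ 4 / 10 - (exp 0 + exp (- 0) - 2)) by (rewrite Ropp_0, exp_0; field).
apply (nondecreasing_of_derive (fun x => x ^ 2 + x ^ 4 / 10 - (exp x + exp (- x) - 2))
     (fun y => 2 * y + 2 / 5 * y ^ 3 - (exp y - exp (- y)))); [lra| |].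
- intros z _; auto_derive; auto; field.
- intros z hz; apply H1; lra.
Qed.

Definition lsum (F : nat -> R) (ms : list nat) : R := fold_right (fun m s => F m + s) 0 ms.

Lemma lsum_app (F : nat -> R) (l1 l2 : list nat) : lsum F (l1 ++ l2) = lsum F l1 + lsum F l2.
Proof. induction l1 as [|m l IH]; simpl; [|rewrite IH]; ring. Qed.

Lemma lsum_le (F G : nat -> R) (ms : list nat) :
  (forall m, In m ms -> F m <= G m) -> lsum F ms <= lsum G ms.
Proof.
induction ms as [|m ms IH]; simpl; intros h; [lra|].
apply Rplus_le_compat; auto.
Qed.

Lemma lsum_scal (c : R) (F : nat -> R) (ms : list nat) : lsum (fun m => c * F m) ms = c * lsum F ms.
Proof. induction ms as [|m l IH]; simpl; [|rewrite IH]; ring. Qed.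

(** A right-endpoint Riemann sum of a decreasing function is below its integral; [Phi] plays the
    role of the integral of [G] from [x] to infinity. *)
Lemma lsum_le_integral (G Phi : R -> R) (b : R) (M : nat) : 0 < b ->
  (forall x, 0 <= x -> is_derive Phi x (- G x)) ->
  (forall x y, 0 <= x <= y -> G y <= G x) ->
  (forall x, 0 <= x -> 0 <= Phi x) ->
  b * lsum (fun m => G (INR m * b)) (seq 1 M) <= Phi 0.
Proof.
intros hb hd hdec hp.
enough (b * lsum (fun m => G (INR m * b)) (seq 1 M) <= Phi 0 - Phi (INR M * b)).
{ assert (0 <= Phi (INR M * b)); [apply hp|lra].
  apply Rmult_le_pos; [apply pos_INR|lra]. }
induction M as [|M IH]; [simpl; rewrite Rmult_0_l; lra|].
rewrite seq_S, lsum_app, Rmult_plus_distr_l.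
replace (1 + M)%nat with (S M) by lia; simpl lsum.
set (x := INR M * b) in *.
assert (hx : 0 <= x) by (apply Rmult_le_pos; [apply pos_INR|lra]).
assert (ey : INR (S M) * b = x + b) by (rewrite S_INR; unfold x; ring).
replace (match M with O => 1 | S _ => INR M + 1 end * b) with (x + b)
  by (rewrite <- ey; reflexivity).
rewrite Rplus_0_r, ?ey.
enough (b * G (x + b) <= Phi x - Phi (x + b)) by lra.
destruct (MVT_gen Phi x (x + b) (fun z => - G z)) as [c [hc e]].
- intros z; rewrite Rmin_left, Rmax_right by lra; intros; apply hd; lra.
- intros z; rewrite Rmin_left, Rmax_right by lra; intros.
  apply derivable_continuous_pt; exists (- G z); apply is_derive_Reals, hd; lra.
- rewrite Rmin_left, Rmax_right in hc by lra.
  assert (G (x + b) <= G c) by (apply hdec; lra); nra.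
Qed.

Lemma poly_exp_decreasing (P P' : R -> R) :
  (forall x, is_derive P x (P' x)) -> (forall x, 0 <= x -> P' x <= P x) ->
  forall x y, 0 <= x <= y -> P y * exp (- y) <= P x * exp (- x).
Proof.
intros hd hle x y hxy.
enough (- (P x * exp (- x)) <= - (P y * exp (- y))) by lra.
apply (nondecreasing_of_derive (fun x => - (P x * exp (- x))) (fun x => (P x - P' x) * exp (- x)));
  [lra| |].
- intros z _; apply (is_derive_ext (fun x => - P x * exp (- x)));
    [intros t; change (- P t * exp (- t) = - (P t * exp (- t))); ring|].
  replace ((P z - P' z) * exp (- z)) with (- P' z * exp (- z) + - P z * (- exp (- z))) by ring.
  apply (is_derive_mult (fun z => - P z) (fun z => exp (- z)) z (- P' z) (- exp (- z))).
  + apply (is_derive_opp P), hd.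
  + auto_derive; auto; ring.
  + intros; apply Rmult_comm.
- intros z hz; apply Rmult_le_pos; [|left; apply exp_pos]; generalize (hle z); lra.
Qed.

(** The integral of [x e^{-x} / (1 - e^{-x})] is [PI ^ 2 / 6]; the polynomial bound
    [div_1_sub_exp_le] replaces it by [1 + 1 / 2 + 1 / 6 = 5 / 3]. In the same way [7 / 2] and
    [25 / 2] replace [PI ^ 2 / 3] and [PI ^ 2] for the next two cumulants. *)
Lemma mean_sum_le (b : R) (M : nat) : 0 < b ->
  lsum (fun m => INR m * (wt b m / (1 - wt b m))) (seq 1 M) <= 5 / 3 / b ^ 2.
Proof.
intros hb.
set (G := fun x => (1 + x / 2 + x ^ 2 / 12) * exp (- x)).
assert (H : b * lsum (fun m => G (INR m * b)) (seq 1 M) <= 5 / 3).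
{ replace (5 / 3) with ((5 / 3 + 2 / 3 * 0 + 0 ^ 2 / 12) * exp (- 0)) by (rewrite Ropp_0, exp_0; field).
  apply (lsum_le_integral G (fun x => (5 / 3 + 2 / 3 * x + x ^ 2 / 12) * exp (- x))); auto.
  - intros x _; unfold G; auto_derive; auto; field.
  - apply (poly_exp_decreasing (fun x => 1 + x / 2 + x ^ 2 / 12) (fun x => 1 / 2 + x / 6)).
    + intros x; auto_derive; auto; field.
    + intros x hx; nra.
  - intros x hx; apply Rmult_le_pos; [nra|left; apply exp_pos]. }
assert (L : lsum (fun m => INR m * (wt b m / (1 - wt b m))) (seq 1 M) <=
            lsum (fun m => / b * G (INR m * b)) (seq 1 M)).
{ apply lsum_le; intros m hm; apply in_seq in hm.
  assert (h1 : 1 <= INR m) by (apply (le_INR 1); lia).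
  set (x := INR m * b); assert (hx : 0 < x) by (unfold x; nra).
  assert (hq := exp_opp_lt1 x hx); unfold wt; fold x; set (q := exp (- x)) in *.
  replace (INR m) with (/ b * x) by (unfold x; field; lra).
  rewrite Rmult_assoc; apply Rmult_le_compat_l; [left; apply Rinv_0_lt_compat; auto|].
  unfold G; fold q; replace (x * (q / (1 - q))) with (x / (1 - q) * q) by (field; lra).
  apply Rmult_le_compat_r; [lra|apply div_1_sub_exp_le; auto]. }
rewrite lsum_scal in L.
apply Rle_trans with (1 := L); apply (Rmult_le_reg_l (b ^ 2)); [nra|].
replace (b ^ 2 * (5 / 3 / b ^ 2)) with (5 / 3) by (field; lra).
replace (b ^ 2 * (/ b * lsum (fun m => G (INR m * b)) (seq 1 M))) with
  (b * lsum (fun m => G (INR m * b)) (seq 1 M)) by (field; lra).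
auto.
Qed.

Lemma variance_sum_le (b : R) (M : nat) : 0 < b ->
  lsum (fun m => INR m ^ 2 * (wt b m / (1 - wt b m) ^ 2)) (seq 1 M) <= 7 / 2 / b ^ 3.
Proof.
intros hb.
set (G := fun x => (1 + x + 5 / 12 * x ^ 2 + x ^ 3 / 12 + x ^ 4 / 144) * exp (- x)).
assert (H : b * lsum (fun m => G (INR m * b)) (seq 1 M) <= 7 / 2).
{ replace (7 / 2) with ((7 / 2 + 5 / 2 * 0 + 3 / 4 * 0 ^ 2 + 0 ^ 3 / 9 + 0 ^ 4 / 144) * exp (- 0))
    by (rewrite Ropp_0, exp_0; field).
  apply (lsum_le_integral G
    (fun x => (7 / 2 + 5 / 2 * x + 3 / 4 * x ^ 2 + x ^ 3 / 9 + x ^ 4 / 144) * exp (- x))); auto.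
  - intros x _; unfold G; auto_derive; auto; field.
  - apply (poly_exp_decreasing (fun x => 1 + x + 5 / 12 * x ^ 2 + x ^ 3 / 12 + x ^ 4 / 144)
      (fun x => 1 + 5 / 6 * x + x ^ 2 / 4 + x ^ 3 / 36)).
    + intros x; auto_derive; auto; field.
    + intros x hx; assert (0 <= x ^ 3) by (apply pow_le; auto).
      assert (0 <= x ^ 4) by (apply pow_le; auto); nra.
  - intros x hx; assert (0 <= x ^ 3) by (apply pow_le; auto).
    assert (0 <= x ^ 4) by (apply pow_le; auto).
    apply Rmult_le_pos; [nra|left; apply exp_pos]. }
assert (L : lsum (fun m => INR m ^ 2 * (wt b m / (1 - wt b m) ^ 2)) (seq 1 M) <=
            lsum (fun m => / b ^ 2 * G (INR m * b)) (seq 1 M)).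
{ apply lsum_le; intros m hm; apply in_seq in hm.
  assert (h1 : 1 <= INR m) by (apply (le_INR 1); lia).
  set (x := INR m * b); assert (hx : 0 < x) by (unfold x; nra).
  assert (hq := exp_opp_lt1 x hx); unfold wt; fold x; set (q := exp (- x)) in *.
  replace (INR m) with (/ b * x) by (unfold x; field; lra).
  rewrite Rpow_mult_distr, pow_inv, Rmult_assoc.
  apply Rmult_le_compat_l; [left; apply Rinv_0_lt_compat, pow_lt; auto|].
  unfold G; fold q; replace (x ^ 2 * (q / (1 - q) ^ 2)) with ((x / (1 - q)) ^ 2 * q) by (field; lra).
  apply Rmult_le_compat_r; [lra|].
  apply Rle_trans with ((1 + x / 2 + x ^ 2 / 12) ^ 2).
  - apply pow_incr; split; [apply Rdiv_le_0_compat; lra|apply div_1_sub_exp_le; auto].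
  - right; field. }
rewrite lsum_scal in L.
apply Rle_trans with (1 := L); apply (Rmult_le_reg_l (b ^ 3)); [apply pow_lt; auto|].
replace (b ^ 3 * (7 / 2 / b ^ 3)) with (7 / 2) by (field; lra).
replace (b ^ 3 * (/ b ^ 2 * lsum (fun m => G (INR m * b)) (seq 1 M))) with
  (b * lsum (fun m => G (INR m * b)) (seq 1 M)) by (field; lra).
auto.
Qed.

Lemma third_sum_le (b : R) (M : nat) : 0 < b ->
  lsum (fun m => INR m ^ 3 * (wt b m * (1 + wt b m) / (1 - wt b m) ^ 3)) (seq 1 M)
    <= 25 / 2 / b ^ 4.
Proof.
intros hb.
set (P := fun x => 2 + 2 * x + x ^ 2 + x ^ 3 / 3 + x ^ 4 / 12 + x ^ 5 / 72 + x ^ 6 / 864).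
set (G := fun x => P x * exp (- x)).
set (Q := fun x => 25 / 2 + 21 / 2 * x + 17 / 4 * x ^ 2 + 13 / 12 * x ^ 3 + 3 / 16 * x ^ 4
  + x ^ 5 / 48 + x ^ 6 / 864).
assert (H : b * lsum (fun m => G (INR m * b)) (seq 1 M) <= 25 / 2).
{ replace (25 / 2) with (Q 0 * exp (- 0)) by (unfold Q; rewrite Ropp_0, exp_0; field).
  apply (lsum_le_integral G (fun x => Q x * exp (- x))); auto.
  - intros x _; unfold G, P, Q; auto_derive; auto; field.
  - apply (poly_exp_decreasing P
      (fun x => 2 + 2 * x + x ^ 2 + x ^ 3 / 3 + 5 / 72 * x ^ 4 + x ^ 5 / 144)).
    + intros x; unfold P; auto_derive; auto; field.
    + intros x hx; unfold P; assert (0 <= x ^ 4) by (apply pow_le; auto).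
      assert (0 <= x ^ 5) by (apply pow_le; auto).
      assert (0 <= x ^ 6) by (apply pow_le; auto); lra.
  - intros x hx; unfold Q; assert (0 <= x ^ 3) by (apply pow_le; auto).
    assert (0 <= x ^ 2) by (apply pow_le; auto).
    assert (0 <= x ^ 4) by (apply pow_le; auto).
    assert (0 <= x ^ 5) by (apply pow_le; auto).
    assert (0 <= x ^ 6) by (apply pow_le; auto).
    apply Rmult_le_pos; [lra|left; apply exp_pos]. }
assert (L : lsum (fun m => INR m ^ 3 * (wt b m * (1 + wt b m) / (1 - wt b m) ^ 3)) (seq 1 M) <=
            lsum (fun m => / b ^ 3 * G (INR m * b)) (seq 1 M)).
{ apply lsum_le; intros m hm; apply in_seq in hm.
  assert (h1 : 1 <= INR m) by (apply (le_INR 1); lia).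
  set (x := INR m * b); assert (hx : 0 < x) by (unfold x; nra).
  assert (hq := exp_opp_lt1 x hx); assert (hd := div_1_sub_exp_le x hx).
  unfold wt; fold x; set (q := exp (- x)) in *.
  replace (INR m) with (/ b * x) by (unfold x; field; lra).
  rewrite Rpow_mult_distr, pow_inv, Rmult_assoc.
  apply Rmult_le_compat_l; [left; apply Rinv_0_lt_compat, pow_lt; auto|].
  unfold G; fold q.
  assert (hd0 : 0 <= x / (1 - q)) by (apply Rdiv_le_0_compat; lra).
  (* In this form only an upper bound on [d = x / (1 - q)] is required. *)
  replace (x ^ 3 * (q * (1 + q) / (1 - q) ^ 3)) with
    ((x / (1 - q)) ^ 2 * (2 * (x / (1 - q)) - x) * q) by (field; lra).
  set (d := x / (1 - q)) in *.
  apply Rmult_le_compat_r; [lra|].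
  apply Rle_trans with ((1 + x / 2 + x ^ 2 / 12) ^ 2 * (2 * (1 + x / 2 + x ^ 2 / 12) - x)).
  - apply Rle_trans with (d ^ 2 * (2 * (1 + x / 2 + x ^ 2 / 12) - x)).
    + apply Rmult_le_compat_l; [apply pow2_ge_0|lra].
    + apply Rmult_le_compat_r; [nra|apply pow_incr; lra].
  - right; unfold P; field. }
rewrite lsum_scal in L.
apply Rle_trans with (1 := L); apply (Rmult_le_reg_l (b ^ 4)); [apply pow_lt; auto|].
replace (b ^ 4 * (25 / 2 / b ^ 4)) with (25 / 2) by (field; lra).
replace (b ^ 4 * (/ b ^ 3 * lsum (fun m => G (INR m * b)) (seq 1 M))) with
  (b * lsum (fun m => G (INR m * b)) (seq 1 M)) by (field; lra).
auto.
Qed.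

(** * Decay of the characteristic function *)

Lemma lsum_cons (F : nat -> R) (m : nat) (ms : list nat) : lsum F (m :: ms) = F m + lsum F ms.
Proof. reflexivity. Qed.

Lemma chmod_cons (b t : R) (m : nat) (ms : list nat) :
  chmod b (m :: ms) t = fmod (wt b m) (INR m * t) * chmod b ms t.
Proof. reflexivity. Qed.

Lemma charg_cons (b t : R) (m : nat) (ms : list nat) :
  charg b (m :: ms) t = farg (wt b m) (INR m * t) + charg b ms t.
Proof. reflexivity. Qed.

Definition parts (k M : nat) : list nat := concat (repeat (seq 1 M) k).

Lemma pos_parts_parts (k M : nat) : pos_parts (parts k M).
Proof.
induction k as [|k IH]; [constructor|].
apply Forall_app; split; auto.
apply List.Forall_forall; intros m hm; apply in_seq in hm; lia.
Qed.

Lemma lsum_parts (F : nat -> R) (k M : nat) : lsum F (parts k M) = INR k * lsum F (seq 1 M).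
Proof.
induction k as [|k IH]; [simpl; ring|].
unfold parts; simpl repeat; simpl concat; rewrite lsum_app, S_INR.
fold (parts k M); rewrite IH; ring.
Qed.

Lemma chmod_ge (b t : R) (ms : list nat) : 0 < b -> pos_parts ms ->
  exp (- (t ^ 2 / 2 * lsum (fun m => INR m ^ 2 * (wt b m / (1 - wt b m) ^ 2)) ms)) <= chmod b ms t.
Proof.
intros hb; induction 1 as [|m ms hm _ IH].
- right; simpl; rewrite Rmult_0_r, Ropp_0; apply exp_0.
- rewrite lsum_cons, chmod_cons; assert (hf := fmod_ge (wt b m) (INR m * t) (wt_bounds b m hb hm)).
  rewrite Rmult_plus_distr_l, Ropp_plus_distr, exp_plus.
  apply Rmult_le_compat; try (left; apply exp_pos); auto.
  apply Rle_trans with (2 := hf); right; do 2 f_equal; field.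
  generalize (wt_bounds b m hb hm); lra.
Qed.

Lemma wt_double (b : R) (m : nat) : wt (2 * b) m = wt b m ^ 2.
Proof.
unfold wt; simpl; rewrite Rmult_1_r, <- exp_plus; f_equal; ring.
Qed.

(** The first term of the exponent in [fmod_le], summed over the parts. The second term sums to half
    of the same expression at [(2 b, 2 t)]. *)
Definition trig_sum (b t : R) (M : nat) : R :=
  lsum (fun m => wt b m * (1 - cos (INR m * t))) (seq 1 M).

Lemma lsum_plus (F G : nat -> R) (ms : list nat) :
  lsum (fun m => F m + G m) ms = lsum F ms + lsum G ms.
Proof. induction ms as [|m l IH]; simpl; [|rewrite IH]; ring. Qed.

Lemma chmod_le (b t : R) (k M : nat) : 0 < b ->
  chmod b (parts k M) t <=
  exp (- (INR k * (trig_sum b t M + trig_sum (2 * b) (2 * t) M / 2))).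
Proof.
intros hb.
assert (H : forall ms, pos_parts ms -> chmod b ms t <= exp (- lsum (fun m =>
  wt b m * (1 - cos (INR m * t)) + / 2 * (wt (2 * b) m * (1 - cos (INR m * (2 * t))))) ms)).
{ induction 1 as [|m ms hm hms IH].
  - right; simpl; rewrite Ropp_0, exp_0; auto.
  - rewrite lsum_cons, chmod_cons; assert (hw := wt_bounds b m hb hm).
    assert (hf := fmod_le (wt b m) (INR m * t) hw).
    rewrite Ropp_plus_distr, exp_plus.
    apply Rmult_le_compat; auto.
    + left; apply fmod_gt0; auto.
    + left; apply chmod_bounds; auto.
    + apply Rle_trans with (1 := hf); right; do 2 f_equal.
      rewrite wt_double; replace (2 * (INR m * t)) with (INR m * (2 * t)) by ring; field. }
apply Rle_trans with (1 := H _ (pos_parts_parts k M)); right; do 2 f_equal.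
rewrite lsum_parts, lsum_plus, lsum_scal; unfold trig_sum; field.
Qed.

Lemma charg_bounds (b t : R) (ms : list nat) : 0 < b -> pos_parts ms -> 0 <= t ->
  0 <= t * lsum (fun m => INR m * (wt b m / (1 - wt b m))) ms - charg b ms t <=
  t ^ 3 / 6 * lsum (fun m => INR m ^ 3 * (wt b m * (1 + wt b m) / (1 - wt b m) ^ 3)) ms.
Proof.
intros hb hms ht; induction hms as [|m ms hm _ IH]; [simpl; lra|rewrite !lsum_cons, charg_cons].
assert (hx : 0 <= INR m * t) by (apply Rmult_le_pos; [apply pos_INR|auto]).
assert (hf := farg_bounds (wt b m) (INR m * t) (wt_bounds b m hb hm) hx).
set (A := wt b m / (1 - wt b m)) in *; set (B := wt b m * (1 + wt b m) / (1 - wt b m) ^ 3) in *.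
replace (INR m * t * A) with (t * (INR m * A)) in hf by ring.
replace ((INR m * t) ^ 3 / 6 * B) with (t ^ 3 / 6 * (INR m ^ 3 * B)) in hf
  by (unfold Rdiv; ring).
rewrite !Rmult_plus_distr_l; lra.
Qed.

Lemma wt_pow (b : R) (m : nat) : wt b m = exp (- b) ^ m.
Proof.
induction m as [|m IH].
- unfold wt; simpl; rewrite Rmult_0_l, Ropp_0; apply exp_0.
- rewrite <- tech_pow_Rmult, <- IH; unfold wt; rewrite <- exp_plus, S_INR; f_equal; ring.
Qed.

(** The first fraction is the infinite sum, [q / (1 - q)] minus the real part of
    [q e^{it} / (1 - q e^{it})]; the second bounds what the cut at [M] removes. *)
Lemma trig_sum_ge (b t : R) (M : nat) (q := exp (- b)) : 0 < b ->
  q * (1 + q) * (1 - cos t) / ((1 - q) * nsq q t) - 3 * q ^ S M / (1 - q) ^ 2 <= trig_sum b t M.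
Proof.
intros hb; assert (hq := exp_opp_lt1 b hb); fold q in hq.
assert (hD := nsq_gt0 q t ltac:(lra)); assert (hD1 := nsq_ge q t ltac:(lra)).
assert (E : trig_sum b t M = q * (1 + q) * (1 - cos t) / ((1 - q) * nsq q t) -
  q ^ S M * (1 / (1 - q) - (cos (INR (S M) * t) - q * cos (INR M * t)) / nsq q t)).
{ induction M as [|M IH].
  - unfold trig_sum; simpl; rewrite Rmult_0_l, Rmult_1_l, cos_0; unfold nsq in *; field; lra.
  - unfold trig_sum in *; rewrite seq_S, lsum_app, IH; replace (1 + M)%nat with (S M) by lia.
    cbn [lsum fold_right]; rewrite wt_pow; fold q.
    replace (cos (INR (S (S M)) * t)) with (2 * cos t * cos (INR (S M) * t) - cos (INR M * t)).
    + rewrite <- (tech_pow_Rmult q (S M)); unfold nsq in *; field; lra.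
    + rewrite !S_INR.
      replace ((INR M + 1 + 1) * t) with ((INR M + 1) * t + t) by ring.
      replace (INR M * t) with ((INR M + 1) * t - t) by ring.
      rewrite (cos_plus _ t), (cos_minus _ t); ring. }
rewrite E.
assert (hp : 0 <= q ^ S M) by (apply pow_le; lra).
enough (q ^ S M * (1 / (1 - q) - (cos (INR (S M) * t) - q * cos (INR M * t)) / nsq q t) <=
  q ^ S M * (3 / (1 - q) ^ 2)) by (unfold Rdiv in *; lra).
apply Rmult_le_compat_l; auto.
set (c := cos (INR (S M) * t) - q * cos (INR M * t)).
assert (hc : - 2 <= c).
{ unfold c; generalize (COS_bound (INR (S M) * t)) (COS_bound (INR M * t)); nra. }
assert (hs : 0 < (1 - q) ^ 2) by nra.
assert (h1 : 1 / (1 - q) <= 1 / (1 - q) ^ 2).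
{ apply Rmult_le_compat_l; [lra|]; apply Rinv_le_contravar; [auto|nra]. }
assert (h2 : - 2 / (1 - q) ^ 2 <= c / nsq q t).
{ apply Rle_trans with (- 2 / nsq q t).
  - apply (Rmult_le_reg_r ((1 - q) ^ 2 * nsq q t)); [nra|].
    replace (- 2 / (1 - q) ^ 2 * ((1 - q) ^ 2 * nsq q t)) with (- 2 * nsq q t) by (field; lra).
    replace (- 2 / nsq q t * ((1 - q) ^ 2 * nsq q t)) with (- 2 * (1 - q) ^ 2) by (field; lra).
    lra.
  - apply Rmult_le_compat_r; [left; apply Rinv_0_lt_compat|]; auto. }
replace (3 / (1 - q) ^ 2) with (1 / (1 - q) ^ 2 - - 2 / (1 - q) ^ 2) by (field; lra).
lra.
Qed.

(** Dividing [nsq q t] by [q] gives [W + 2 c] with [W = e^b + e^{-b} - 2]. Since [c / (W + 2 c)]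
    increases in [c], any lower bound [v] of [1 - cos t] may be inserted. *)
Lemma trig_main_ge (b t v : R) (q := exp (- b)) : 0 < b <= 3 / 10 -> 0 <= v <= 1 - cos t ->
  2 / b * (v / (b ^ 2 + b ^ 4 / 10 + 2 * v)) <= q * (1 + q) * (1 - cos t) / ((1 - q) * nsq q t).
Proof.
intros hb hv; assert (hq := exp_opp_lt1 b (proj1 hb)); fold q in hq.
set (c := 1 - cos t) in *.
set (W := (1 - q) ^ 2 / q).
assert (hW0 : 0 < W) by (apply Rdiv_lt_0_compat; [nra|lra]).
assert (hW : W <= b ^ 2 + b ^ 4 / 10).
{ replace W with (exp b + exp (- b) - 2); [apply exp_add_exp_opp_le; lra|].
  unfold W; fold q; replace (exp b) with (/ q) by (unfold q; rewrite exp_Ropp, Rinv_inv; auto).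
  field; lra. }
replace (q * (1 + q) * c / ((1 - q) * nsq q t)) with ((1 + q) / (1 - q) * (c / (W + 2 * c))).
2: { rewrite nsq_alt; fold c; unfold W; field; repeat split; try lra; nra. }
apply Rmult_le_compat.
- left; apply Rdiv_lt_0_compat; lra.
- apply Rdiv_le_0_compat; [lra|].
  assert (0 < b ^ 2) by (apply pow_lt; lra); assert (0 < b ^ 4) by (apply pow_lt; lra); lra.
- apply two_div_le; lra.
- apply Rle_trans with (v / (W + 2 * v)).
  + apply Rmult_le_compat_l; [lra|]; apply Rinv_le_contravar; lra.
  + apply (Rmult_le_reg_r ((W + 2 * v) * (W + 2 * c))); [nra|].
    replace (v / (W + 2 * v) * ((W + 2 * v) * (W + 2 * c))) with (v * (W + 2 * c)) by (field; lra).
    replace (c / (W + 2 * c) * ((W + 2 * v) * (W + 2 * c))) with (c * (W + 2 * v)) by (field; lra).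
    nra.
Qed.

(* Bounds the error of cutting the geometric series behind [trig_sum] at [M];
   it is made negligible by taking [M] large, which does not affect [p_k(n)]. *)
Definition tail (b : R) (M : nat) : R := 3 * exp (- b) ^ S M / (1 - exp (- b)) ^ 2.

Lemma trig_sum_nonneg (b t : R) (M : nat) : 0 <= trig_sum b t M.
Proof.
unfold trig_sum; induction (seq 1 M) as [|m l IH]; simpl; [lra|].
apply Rplus_le_le_0_compat; auto; apply Rmult_le_pos; [left; apply exp_pos|].
generalize (COS_bound (INR m * t)); lra.
Qed.

Lemma frac_le_of_mul (a c x y : R) : 0 < y -> a * y <= c * x -> 0 < x -> a / x <= c / y.
Proof.
intros hy h hx; apply (Rmult_le_reg_r (x * y)); [nra|].
replace (a / x * (x * y)) with (a * y) by (field; lra).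
replace (c / y * (x * y)) with (c * x) by (field; lra); auto.
Qed.

(** The first sum is close to [t ^ 2 / b ^ 3 / (1 + t ^ 2 / b ^ 2)], hence about [4 / 5] of
    [t ^ 2 / b ^ 3] or more. The second term is about a quarter of the first and supplies the
    missing [1 / 5]; [99 / 100] leaves room for the errors. *)
Lemma trig_central (b t : R) (M : nat) : 0 < b <= 5 / 36 -> 0 <= t <= b / 2 ->
  99 / 100 * t ^ 2 / b ^ 3 - tail b M - tail (2 * b) M / 2 <=
  trig_sum b t M + trig_sum (2 * b) (2 * t) M / 2.
Proof.
intros hb ht.
(* [e] bounds both relative errors, [c ^ 2 / 10] from the hyperbolic cosine and [s ^ 2 / 12] from
   the cosine. *)
assert (K : forall c s e, 0 < c <= 5 / 18 -> 0 <= s <= c / 2 -> 0 <= e <= 1 / 2 ->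
  c ^ 2 <= 10 * e -> s ^ 2 <= 12 * e ->
  s ^ 2 / c ^ 3 * ((1 - e) / (5 / 4 + e)) - tail c M <= trig_sum c s M).
{ intros c s e hc hs he h1 h2.
  assert (T1 := trig_sum_ge c s M (proj1 hc)); cbv zeta in T1.
  assert (hv := one_sub_cos_ge s (proj1 hs)).
  assert (hs2 : s ^ 2 <= c ^ 2 / 4) by nra.
  assert (hc2 : 0 < c ^ 2) by nra; assert (hc2' : c ^ 2 <= 25 / 324) by nra.
  assert (hs0 : 0 <= s ^ 2) by nra.
  set (v := s ^ 2 / 2 * (1 - s ^ 2 / 12)).
  assert (hv' : 0 <= v <= 1 - cos s).
  { split; [unfold v; apply Rmult_le_pos; lra|].
    apply Rle_trans with (2 := hv); right; unfold v; field. }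
  assert (T2 := trig_main_ge c s v ltac:(lra) hv'); cbv zeta in T2.
  enough (s ^ 2 / c ^ 3 * ((1 - e) / (5 / 4 + e)) <= 2 / c * (v / (c ^ 2 + c ^ 4 / 10 + 2 * v)))
    by (unfold tail; lra).
  replace (s ^ 2 / c ^ 3 * ((1 - e) / (5 / 4 + e))) with
    (2 / c * ((s ^ 2 / 2 * (1 - e)) / (c ^ 2 * (5 / 4 + e)))) by (field; lra).
  apply Rmult_le_compat_l; [left; apply Rdiv_lt_0_compat; lra|].
  assert (hc4 : c ^ 4 = c ^ 2 * c ^ 2) by ring; rewrite hc4.
  assert (hvs : v <= s ^ 2 / 2) by (unfold v; nra).
  unfold Rdiv; apply Rmult_le_compat.
  - apply Rmult_le_pos; lra.
  - left; apply Rinv_0_lt_compat; nra.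
  - unfold v; nra.
  - apply Rinv_le_contravar; nra. }
assert (K1 := K b t (1 / 500) ltac:(lra) ltac:(lra) ltac:(lra) ltac:(nra) ltac:(nra)).
assert (K2 := K (2 * b) (2 * t) (1 / 125) ltac:(lra) ltac:(lra) ltac:(lra) ltac:(nra) ltac:(nra)).
replace ((2 * t) ^ 2 / (2 * b) ^ 3) with (1 / 2 * (t ^ 2 / b ^ 3)) in K2 by (field; lra).
assert (h : 0 <= t ^ 2 / b ^ 3) by (apply Rdiv_le_0_compat; [nra|apply pow_lt; lra]).
replace (99 / 100 * t ^ 2 / b ^ 3) with (99 / 100 * (t ^ 2 / b ^ 3)) by (field; lra).
set (X := t ^ 2 / b ^ 3) in *.
replace (X * ((1 - 1 / 500) / (5 / 4 + 1 / 500))) with (X * (499 / 626)) in K1 by field.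
replace (1 / 2 * X * ((1 - 1 / 125) / (5 / 4 + 1 / 125))) with (X * (248 / 629)) in K2 by field.
lra.
Qed.

(** As [1 - cos] increases on [[0, PI]], the bound at [t = s b] persists to its right. There [c] is
    [s ^ 2 / (1 + s ^ 2)] up to small corrections. *)
Lemma trig_outer (b t s c : R) (M : nat) : 0 < b <= 3 / 10 -> 0 <= s -> 0 <= c ->
  c * (1 + b ^ 2 / 10 + s ^ 2) <= s ^ 2 * (1 - (s * b) ^ 2 / 12) ->
  s * b <= t <= PI -> c / b - tail b M <= trig_sum b t M.
Proof.
intros hb hs hc0 hc ht.
assert (T1 := trig_sum_ge b t M (proj1 hb)); cbv zeta in T1.
remember (s * b) as x eqn:ex.
assert (hx : 0 <= x) by nra.
assert (hv := one_sub_cos_ge x hx).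
assert (hx0 : 0 <= x ^ 2) by nra; assert (hs2 : 0 <= s ^ 2) by nra.
assert (hb2 : 0 < b ^ 2) by nra.
assert (hy : x ^ 2 = s ^ 2 * b ^ 2) by (rewrite ex; ring).
set (y := 1 - x ^ 2 / 12) in *.
(* If the Taylor bound is not positive, the hypothesis on [c] forces [c = 0]. *)
destruct (Rle_lt_dec y 0) as [y0|y0].
{ assert (c = 0) as -> by nra.
  assert (h0 := trig_sum_nonneg b t M).
  assert (hq := exp_opp_lt1 b (proj1 hb)).
  assert (0 <= tail b M).
  { unfold tail; apply Rdiv_le_0_compat; [|nra].
    apply Rmult_le_pos; [lra|apply pow_le; lra]. }
  unfold Rdiv; rewrite Rmult_0_l; lra. }
set (v := x ^ 2 / 2 * y).
assert (hv' : 0 <= v <= 1 - cos t).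
{ split; [unfold v; apply Rmult_le_pos; lra|].
  assert (cos t <= cos x) by (apply cos_decr_1; lra).
  assert (v = x ^ 2 / 2 - x ^ 4 / 24) by (unfold v, y; field).
  lra. }
assert (T2 := trig_main_ge b t v ltac:(lra) hv'); cbv zeta in T2.
enough (c / b <= 2 / b * (v / (b ^ 2 + b ^ 4 / 10 + 2 * v))) by (unfold tail; lra).
replace (c / b) with (2 / b * (c / 2)) by (field; lra).
apply Rmult_le_compat_l; [left; apply Rdiv_lt_0_compat; lra|].
replace (b ^ 4) with (b ^ 2 * b ^ 2) by ring.
apply frac_le_of_mul; [nra| |lra].
unfold v; rewrite hy.
apply Rle_trans with (b ^ 2 * (c * (1 + b ^ 2 / 10 + s ^ 2))).
- replace (c * (b ^ 2 + b ^ 2 * b ^ 2 / 10 + 2 * (s ^ 2 * b ^ 2 / 2 * y))) with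
    (b ^ 2 * (c * (1 + b ^ 2 / 10 + s ^ 2 * y))) by field.
  apply Rmult_le_compat_l; [lra|]; apply Rmult_le_compat_l; [auto|].
  assert (s ^ 2 * y <= s ^ 2 * 1) by (apply Rmult_le_compat_l; unfold y; lra); lra.
- apply Rle_trans with (b ^ 2 * (s ^ 2 * y)); [|right; field].
  apply Rmult_le_compat_l; lra.
Qed.

(** * Positivity of the integral *)

Lemma exp_ge_quadratic (x : R) : 0 <= x -> 1 + x + x ^ 2 / 2 <= exp x.
Proof.
intros hx; enough (0 <= exp x - (1 + x + x ^ 2 / 2)) by lra.
replace 0 with (exp 0 - (1 + 0 + 0 ^ 2 / 2)) by (rewrite exp_0; field).
apply (nondecreasing_of_derive (fun x => exp x - (1 + x + x ^ 2 / 2)) (fun x => exp x - (1 + x))); auto.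
- intros z _; auto_derive; auto; field.
- intros z _; generalize (exp_ineq1_le z); lra.
Qed.

Lemma exp_mult_nat (x : R) (n : nat) : exp (INR n * x) = exp x ^ n.
Proof.
induction n as [|n IH]; [rewrite Rmult_0_l, exp_0; auto|].
rewrite <- tech_pow_Rmult, <- IH, <- exp_plus, S_INR; f_equal; ring.
Qed.

(** The value is about 0.0744, and the bound is used with little slack. Cutting the exponent into 20
    equal pieces makes a quadratic Taylor bound precise enough. *)
Lemma exp_shoulder : exp (- (99 / 100 * (81 / 50) ^ 2)) <= 3 / 40.
Proof.
assert (h := exp_ge_quadratic (1299 / 10000) ltac:(lra)).
assert (40 / 3 <= exp (2598 / 1000)).
{ replace (2598 / 1000) with (INR 20 * (1299 / 10000)) by (simpl; field).
  rewrite exp_mult_nat.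
  apply Rle_trans with ((11383 / 10000) ^ 20); [lra|apply pow_incr; lra]. }
apply Rle_trans with (exp (- (2598 / 1000))); [apply exp_le; lra|].
rewrite exp_Ropp; replace (3 / 40) with (/ (40 / 3)) by field; apply Rinv_le_contravar; lra.
Qed.

Lemma exp_slope : 46 / 1000 <= exp (- (7 / 4 * (13 / 10) ^ 2)).
Proof.
assert (h := exp_ineq1_le (- (7 / 4 * (13 / 10) ^ 2 / 40))).
replace (- (7 / 4 * (13 / 10) ^ 2)) with (INR 40 * (- (7 / 4 * (13 / 10) ^ 2 / 40)))
  by (simpl; field).
rewrite exp_mult_nat; apply Rle_trans with ((926 / 1000) ^ 40); [lra|apply pow_incr; lra].
Qed.

(** The rate is half of [247 / 1000], the decay available from [t = b / 2] on. The powers 2, 3 and 6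
    of this estimate serve the last three intervals. *)
Lemma exp_outer (rho : R) : 36 <= rho -> exp (- (1235 / 10000 * rho)) <= 20 / 41 / rho.
Proof.
intros h; rewrite exp_Ropp; replace (20 / 41 / rho) with (/ (41 / 20 * rho)) by (field; lra).
apply Rinv_le_contravar; [lra|].
assert (h1 := exp_ge_quadratic (2223 / 10000) ltac:(lra)).
assert (h2 : 80 <= exp (4446 / 1000)).
{ replace (4446 / 1000) with (INR 20 * (2223 / 10000)) by (simpl; field).
  rewrite exp_mult_nat.
  apply Rle_trans with ((1247 / 1000) ^ 20); [lra|apply pow_incr; lra]. }
replace (1235 / 10000 * rho) with (4446 / 1000 + 1235 / 10000 * (rho - 36)) by field.
rewrite exp_plus; assert (h3 := exp_ineq1_le (1235 / 10000 * (rho - 36))); nra.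
Qed.

Lemma RInt_ge_antiderivative (g l L : R -> R) (x y : R) : x <= y ->
  (forall t, continuous g t) -> (forall t, is_derive L t (l t)) -> (forall t, ex_derive l t) ->
  (forall t, x <= t <= y -> l t <= g t) -> L y - L x <= RInt g x y.
Proof.
intros hxy hg hL hl hle.
assert (I : is_RInt l x y (L y - L x)).
{ apply (is_RInt_derive L l); intros t _; auto.
  apply (ex_derive_continuous (V := R_NormedModule)), hl. }
rewrite <- (is_RInt_unique _ _ _ _ I).
apply RInt_le; auto.
- eexists; apply I.
- apply (@ex_RInt_continuous R_CompleteNormedModule); auto.
- intros t ht; apply hle; lra.
Qed.

(* The interval [0, PI] is cut at [s, 1.3 s, 1.62 s, b/2, 0.7 b, 2b], where [s]
   is comparable to the inverse of the standard deviation.  In units of [s ^ 3]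
   the integral of [g] over the pieces is at least [0.0434], [0.0064], [0]
   (the phase is still below [PI / 2]), [- 0.043], [- 0.0015], [- 0.0008] and
   [- 0.001]. *)
Section Zones.

Variables (b : R) (k n M : nat).
Let ms := parts k M.
Let K := INR k.
(** [1 / s ^ 2 = K / b ^ 3] is the order of the variance, so [s] is the width of the peak, while [F]
    changes its shape on the scale [b]; [r] is the ratio of the two scales. *)
Let r := sqrt (K / b).
Let s := b / r.

Hypothesis hb : 0 < b <= 5 / 36.
Hypothesis hk : 3 <= K.
Hypothesis hrho : 36 <= K / b.
Hypothesis hmean : lsum (fun m => INR m * (wt b m / (1 - wt b m))) ms = INR n.
Hypothesis htail : K * (tail b M + tail (2 * b) M / 2) <= 1 / 200.

Let g t := fourier b ms (Z.of_nat n) t * (1 - cos t).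

Lemma r_sq : r ^ 2 = K / b. Proof. apply pow2_sqrt; lra. Qed.

Lemma r_ge : 6 <= r.
Proof.
apply Rsqr_incr_0_var; [|apply sqrt_pos]; rewrite !Rsqr_pow2, r_sq; lra.
Qed.

Lemma s_gt0 : 0 < s. Proof. apply Rdiv_lt_0_compat; generalize r_ge; lra. Qed.

Lemma s_le : s <= b / 6.
Proof.
apply Rmult_le_compat_l; [lra|]; apply Rinv_le_contravar; generalize r_ge; lra.
Qed.

Lemma s_sq : K / b ^ 3 = 1 / s ^ 2.
Proof.
assert (h := r_ge); assert (e := r_sq); unfold s.
replace (1 / (b / r) ^ 2) with (r ^ 2 / b ^ 2) by (field; lra).
rewrite e; field; lra.
Qed.

Lemma g_continuous (t : R) : continuous g t.
Proof.
apply (continuous_mult (K := R_AbsRing) (fourier b ms (Z.of_nat n))).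
- apply continuous_fourier; [lra|apply pos_parts_parts].
- apply (ex_derive_continuous (V := R_NormedModule)); auto_derive; auto.
Qed.

Lemma modulus_ge (t : R) : exp (- (7 / 4 * (t / s) ^ 2)) <= chmod b ms t.
Proof.
apply Rle_trans with (2 := chmod_ge b t ms (proj1 hb) (pos_parts_parts k M)).
apply exp_le, Ropp_le_contravar; unfold ms; rewrite lsum_parts.
assert (h := variance_sum_le b M (proj1 hb)).
set (X := lsum _ _) in *.
assert (e := s_sq); assert (hs := s_gt0).
replace (7 / 4 * (t / s) ^ 2) with (t ^ 2 / 2 * (K * (7 / 2 / b ^ 3))).
- apply Rmult_le_compat_l; [generalize (pow2_ge_0 t); lra|].
  apply Rmult_le_compat_l; [apply pos_INR|auto].
- replace (K * (7 / 2 / b ^ 3)) with (7 / 2 * (K / b ^ 3)) by (field; lra).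
  rewrite e; field; lra.
Qed.

(** The choice of the mean cancels the linear term. Since [K * s ^ 3 / b ^ 4 = 1 / r], the third
    cumulant contributes [25 / 2 / 6] times [(t / s) ^ 3 / r]. *)
Lemma phase_bounds (t : R) : 0 <= t ->
  0 <= INR n * t - charg b ms t <= 25 / 12 * (t / s) ^ 3 / r.
Proof.
intros ht.
assert (h := charg_bounds b t ms (proj1 hb) (pos_parts_parts k M) ht).
rewrite hmean, Rmult_comm in h; split; [lra|].
apply Rle_trans with (1 := proj2 h).
unfold ms; rewrite lsum_parts; fold K.
assert (h3 := third_sum_le b M (proj1 hb)).
apply Rle_trans with (t ^ 3 / 6 * (K * (25 / 2 / b ^ 4))).
- apply Rmult_le_compat_l; [assert (0 <= t ^ 3) by (apply pow_le; auto); lra|].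
  apply Rmult_le_compat_l; [lra|auto].
- right; assert (hr := r_ge); assert (e := r_sq).
  replace K with (r ^ 2 * b) by (rewrite e; field; lra); unfold s; field; lra.
Qed.

Lemma fourier_alt (t : R) :
  g t = chmod b ms t * cos (INR n * t - charg b ms t) * (1 - cos t).
Proof.
unfold g, fourier; rewrite <- INR_IZR_INZ.
rewrite <- (cos_neg (charg b ms t - _)); do 3 f_equal; ring.
Qed.

(** Replacing [exp (- (7 / 4 * u ^ 2))] by [(1 - 7 / 8 * u ^ 2) ^ 2] leaves a polynomial to
    integrate. The constant is below [9397 / 10000 * (999 / 2000)], from the cosine of the phase and
    from [1 - cos t]. *)
Lemma g_ge_peak (t : R) : 0 <= t <= s ->
  469 / 1000 * (t ^ 2 * (1 - 7 / 8 * (t / s) ^ 2) ^ 2) <= g t.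
Proof.
intros ht; assert (hs := s_gt0); assert (hsl := s_le); assert (hr := r_ge).
assert (h := phase_bounds t (proj1 ht)); set (h0 := INR n * t - charg b ms t) in *.
set (u := t / s) in *.
assert (hu : 0 <= u <= 1).
{ unfold u; split; [apply Rdiv_le_0_compat; lra|].
  apply (Rmult_le_reg_r s); auto; unfold Rdiv; rewrite Rmult_assoc, Rinv_l; lra. }
assert (hh : h0 <= 25 / 72).
{ apply Rle_trans with (1 := proj2 h).
  apply (Rmult_le_reg_r r); [lra|]; unfold Rdiv at 1; rewrite Rmult_assoc, Rinv_l by lra.
  assert (u ^ 3 <= 1) by (rewrite <- (pow1 3); apply pow_incr; auto); lra. }
assert (hc : 9397 / 10000 <= cos h0) by (generalize (one_sub_cos_le h0); nra).
assert (hm : (1 - 7 / 8 * u ^ 2) ^ 2 <= chmod b ms t).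
{ apply Rle_trans with (2 := modulus_ge t); fold u.
  replace (- (7 / 4 * u ^ 2)) with (- (7 / 8 * u ^ 2) + - (7 / 8 * u ^ 2)) by field.
  rewrite exp_plus; assert (he := exp_ineq1_le (- (7 / 8 * u ^ 2))).
  assert (u ^ 2 <= 1) by nra; nra. }
assert (ht2 : t ^ 2 <= 1 / 1000) by nra.
assert (h1c : 999 / 2000 * t ^ 2 <= 1 - cos t).
{ apply Rle_trans with (2 := one_sub_cos_ge t (proj1 ht)).
  replace (t ^ 4) with (t ^ 2 * t ^ 2) by ring; nra. }
rewrite fourier_alt; fold h0.
apply Rle_trans with ((1 - 7 / 8 * u ^ 2) ^ 2 * (9397 / 10000) * (999 / 2000 * t ^ 2)).
- assert (0 <= t ^ 2 * (1 - 7 / 8 * u ^ 2) ^ 2) by (apply Rmult_le_pos; apply pow2_ge_0); lra.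
- assert (0 <= (1 - 7 / 8 * u ^ 2) ^ 2) by apply pow2_ge_0.
  apply Rmult_le_compat; [nra|nra| |auto].
  apply Rmult_le_compat; lra.
Qed.

Lemma g_ge_slope (t : R) : s <= t <= 13 / 10 * s -> 162 / 10000 * t ^ 2 <= g t.
Proof.
intros ht; assert (hs := s_gt0); assert (hsl := s_le); assert (hr := r_ge).
assert (ht0 : 0 <= t) by lra.
assert (h := phase_bounds t ht0); set (h0 := INR n * t - charg b ms t) in *.
assert (hm := modulus_ge t).
set (u := t / s) in *.
assert (hu : 0 <= u <= 13 / 10).
{ unfold u; split; [apply Rdiv_le_0_compat; lra|].
  apply (Rmult_le_reg_r s); auto; unfold Rdiv at 1; rewrite Rmult_assoc, Rinv_l; lra. }
assert (hh : h0 <= 763 / 1000).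
{ apply Rle_trans with (1 := proj2 h).
  apply (Rmult_le_reg_r r); [lra|]; unfold Rdiv at 1; rewrite Rmult_assoc, Rinv_l by lra.
  assert (u ^ 3 <= (13 / 10) ^ 3) by (apply pow_incr; auto); lra. }
assert (hc : 7089 / 10000 <= cos h0) by (generalize (one_sub_cos_le h0); nra).
assert (hm' : 46 / 1000 <= chmod b ms t).
{ apply Rle_trans with (2 := hm), Rle_trans with (1 := exp_slope).
  apply exp_le; assert (u ^ 2 <= (13 / 10) ^ 2) by (apply pow_incr; auto); lra. }
assert (ht2 : t ^ 2 <= 1 / 1000) by nra.
assert (h1c : 999 / 2000 * t ^ 2 <= 1 - cos t).
{ apply Rle_trans with (2 := one_sub_cos_ge t ht0).
  replace (t ^ 4) with (t ^ 2 * t ^ 2) by ring; nra. }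
rewrite fourier_alt; fold h0.
apply Rle_trans with (46 / 1000 * (7089 / 10000) * (999 / 2000 * t ^ 2)); [nra|].
apply Rmult_le_compat; [lra|nra| |auto].
apply Rmult_le_compat; lra.
Qed.

(** The end point comes from [25 / 72 * (81 / 50) ^ 3 < 3 / 2 < PI / 2], the phase bound at
    [r = 6]. *)
Lemma g_nonneg (t : R) : 0 <= t <= 81 / 50 * s -> 0 <= g t.
Proof.
intros ht; assert (hs := s_gt0); assert (hr := r_ge).
assert (h := phase_bounds t (proj1 ht)); set (h0 := INR n * t - charg b ms t) in *.
set (u := t / s) in *.
assert (hu : 0 <= u <= 81 / 50).
{ unfold u; split; [apply Rdiv_le_0_compat; lra|].
  apply (Rmult_le_reg_r s); auto; unfold Rdiv at 1; rewrite Rmult_assoc, Rinv_l; lra. }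
assert (hh : h0 <= 3 / 2).
{ apply Rle_trans with (1 := proj2 h).
  apply (Rmult_le_reg_r r); [lra|]; unfold Rdiv at 1; rewrite Rmult_assoc, Rinv_l by lra.
  assert (u ^ 3 <= (81 / 50) ^ 3) by (apply pow_incr; auto); lra. }
assert (hpi := PI2_3_2).
rewrite fourier_alt; fold h0.
apply Rmult_le_pos; [|generalize (COS_bound t); lra].
apply Rmult_le_pos; [left; apply chmod_bounds; [lra|apply pos_parts_parts]|].
apply cos_ge_0; lra.
Qed.

(** Beyond the peak the phase is ignored. The factor [101 / 100] absorbs [exp (1 / 200)], the effect
    of the cut at [M]. *)
Lemma g_ge_opp (t x y : R) : 1 - cos t <= y ->
  x / b - tail b M - tail (2 * b) M / 2 <= trig_sum b t M + trig_sum (2 * b) (2 * t) M / 2 ->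
  - (101 / 100 * exp (- (x * (K / b))) * y) <= g t.
Proof.
intros hy hx.
assert (hm : chmod b ms t <= 101 / 100 * exp (- (x * (K / b)))).
{ apply Rle_trans with (1 := chmod_le b t k M (proj1 hb)).
  apply Rle_trans with (exp (1 / 200 + - (x * (K / b)))).
  - apply exp_le; fold K.
    assert (H : K * (x / b - (tail b M + tail (2 * b) M / 2)) <=
      K * (trig_sum b t M + trig_sum (2 * b) (2 * t) M / 2)) by (apply Rmult_le_compat_l; lra).
    replace (x * (K / b)) with (K * (x / b)) by (field; lra); lra.
  - rewrite exp_plus; apply Rmult_le_compat_r; [left; apply exp_pos|].
    assert (h1 := exp_ineq1_le (- (1 / 200))); rewrite exp_Ropp in h1.
    assert (h2 := exp_pos (1 / 200)).
    apply (Rmult_le_compat_r (exp (1 / 200))) in h1; [|lra].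
    rewrite Rinv_l in h1 by lra; lra. }
assert (hc := COS_bound t).
destruct (chmod_bounds b ms t (proj1 hb) (pos_parts_parts k M)) as [hp _].
rewrite fourier_alt; set (h0 := INR n * t - charg b ms t).
assert (hh := COS_bound h0).
apply Rle_trans with (- (chmod b ms t * (1 - cos t))).
- apply Ropp_le_contravar, Rmult_le_compat; lra.
- assert (0 <= chmod b ms t * (1 - cos t)) by (apply Rmult_le_pos; lra).
  replace (chmod b ms t * cos h0 * (1 - cos t)) with (cos h0 * (chmod b ms t * (1 - cos t))) by ring.
  nra.
Qed.

(** The factor [t / (81 / 50 * s) >= 1] is inserted because [t ^ 3 e^{-a t ^ 2}], unlike
    [t ^ 2 e^{-a t ^ 2}], has an elementary antiderivative. *)
Lemma g_ge_shoulder (t : R) : 81 / 50 * s <= t <= b / 2 ->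
  - (101 / 324 / s * (t ^ 3 * exp (- (99 / 100 * (t / s) ^ 2)))) <= g t.
Proof.
intros ht; assert (hs := s_gt0).
assert (ht0 : 0 <= t) by lra.
assert (hT := trig_central b t M hb (conj ht0 (proj2 ht))).
assert (h := g_ge_opp t (99 / 100 * t ^ 2 / b ^ 2) (t ^ 2 / 2) (one_sub_cos_le t)).
assert (e := s_sq).
replace (99 / 100 * t ^ 2 / b ^ 2 * (K / b)) with (99 / 100 * (t / s) ^ 2) in h.
2: { replace (99 / 100 * t ^ 2 / b ^ 2 * (K / b)) with (99 / 100 * t ^ 2 * (K / b ^ 3))
       by (field; lra); rewrite e; field; lra. }
apply Rle_trans with (2 := h ltac:(replace (99 / 100 * t ^ 2 / b ^ 2 / b) with (99 / 100 * t ^ 2 / b ^ 3)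
  by (field; lra); lra)).
apply Ropp_le_contravar.
set (X := exp _); assert (hX : 0 < X) by apply exp_pos.
replace (101 / 324 / s * (t ^ 3 * X)) with (101 / 100 * X * (t ^ 2 / 2 * (t / (81 / 50 * s))))
  by (field; lra).
apply Rmult_le_compat_l; [lra|].
rewrite <- (Rmult_1_r (t ^ 2 / 2)) at 1; apply Rmult_le_compat_l; [nra|].
apply (Rmult_le_reg_r (81 / 50 * s)); [lra|].
unfold Rdiv at 2; rewrite Rmult_assoc, Rinv_l; lra.
Qed.

Lemma tail_nonneg (c : R) : 0 < c -> 0 <= tail c M.
Proof.
intros hc; assert (hq := exp_opp_lt1 c hc); unfold tail.
apply Rdiv_le_0_compat; [|nra].
apply Rmult_le_pos; [lra|apply pow_le; lra].
Qed.

(** The two sums give [e / b] and half of [e / (2 b)], together [5 / 4 * (e / b)]. The numbers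
    [1 / 125] and [1 / 300] bound the corrections in [trig_outer] at [2 b], hence also at [b]. *)
Lemma g_ge_flank (c d t : R) : 0 <= c <= 7 / 10 -> 0 <= d ->
  d * (1 + 1 / 125 + c ^ 2) <= 5 / 4 * (c ^ 2 * (1 - 1 / 300)) ->
  c * b <= t <= 2 * b -> - (101 / 200 * exp (- (d * (K / b))) * t ^ 2) <= g t.
Proof.
intros hc hd hcd ht; assert (hpi := PI2_3_2).
assert (h := g_ge_opp t d (t ^ 2 / 2) (one_sub_cos_le t)).
set (e := 4 / 5 * d).
assert (he : e * (1 + 1 / 125 + c ^ 2) <= c ^ 2 * (1 - 1 / 300)) by (unfold e; lra).
assert (hc2 : 0 <= c ^ 2) by nra.
assert (hcb : 0 <= c * b <= 7 / 72) by nra.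
assert (he0 : 0 <= e) by (unfold e; lra).
assert (h1 : c ^ 2 * (1 - 1 / 300) <= c ^ 2 * (1 - (c * b) ^ 2 / 12))
  by (apply Rmult_le_compat_l; nra).
assert (h2 : c ^ 2 * (1 - 1 / 300) <= c ^ 2 * (1 - (c * (2 * b)) ^ 2 / 12))
  by (apply Rmult_le_compat_l; nra).
assert (h3 : e * (1 + b ^ 2 / 10 + c ^ 2) <= e * (1 + 1 / 125 + c ^ 2))
  by (apply Rmult_le_compat_l; nra).
assert (h4 : e * (1 + (2 * b) ^ 2 / 10 + c ^ 2) <= e * (1 + 1 / 125 + c ^ 2))
  by (apply Rmult_le_compat_l; nra).
assert (T1 := trig_outer b t c e M ltac:(lra) ltac:(lra) ltac:(lra) ltac:(lra) ltac:(lra)).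
assert (T2 := trig_outer (2 * b) (2 * t) c e M ltac:(lra) ltac:(lra) ltac:(lra) ltac:(lra) ltac:(lra)).
replace (e / (2 * b)) with (e / b / 2) in T2 by (field; lra).
replace (d / b) with (5 / 4 * (e / b)) in h by (unfold e; field; lra).
lra.
Qed.

(** Here [2 t] can pass [PI], and the second sum vanishes at [t = PI], so only the first is kept;
    [79 / 100] is just below [2 ^ 2 / (1 + 2 ^ 2)]. *)
Lemma g_ge_minor (t : R) : 2 * b <= t <= PI ->
  - (202 / 100 * exp (- (79 / 100 * (K / b)))) <= g t.
Proof.
intros ht.
assert (h := g_ge_opp t (79 / 100) 2 ltac:(generalize (COS_bound t); lra)).
assert (hT := trig_outer b t 2 (79 / 100) M ltac:(lra) ltac:(lra) ltac:(lra)
  ltac:(nra) ltac:(lra)).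
assert (h0 := trig_sum_nonneg (2 * b) (2 * t) M); assert (h1 := tail_nonneg (2 * b) ltac:(lra)).
lra.
Qed.

Lemma integral_gt0 : 0 < RInt g 0 PI.
Proof.
assert (hs := s_gt0); assert (hsl := s_le); assert (hr := r_ge); assert (hpi := PI2_3_2).
assert (hg : forall x y, ex_RInt g x y).
{ intros; apply (@ex_RInt_continuous R_CompleteNormedModule); intros; apply g_continuous. }
assert (C : forall x y z, RInt g x z = RInt g x y + RInt g y z).
{ intros x y z; symmetry; apply (RInt_Chasles (V := R_CompleteNormedModule) g); auto. }
rewrite (C 0 s PI), (C s (13 / 10 * s) PI), (C (13 / 10 * s) (81 / 50 * s) PI),
  (C (81 / 50 * s) (b / 2) PI), (C (b / 2) (7 / 10 * b) PI), (C (7 / 10 * b) (2 * b) PI).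
assert (I1 : 434 / 10000 * s ^ 3 <= RInt g 0 s).
{ set (L := fun t => 469 / 1000 * (t ^ 3 / 3 - 7 / 20 * (t ^ 5 / s ^ 2) + 7 / 64 * (t ^ 7 / s ^ 4))).
  apply Rle_trans with (L s - L 0).
  - assert (0 < s ^ 3) by (apply pow_lt; auto).
    replace (L s - L 0) with (469 / 1000 * (1 / 3 - 7 / 20 + 7 / 64) * s ^ 3)
      by (unfold L; field; lra); lra.
  - apply (RInt_ge_antiderivative g
      (fun t => 469 / 1000 * (t ^ 2 * (1 - 7 / 8 * (t / s) ^ 2) ^ 2))); auto using g_continuous.
    + lra.
    + intros t; unfold L; auto_derive; auto; field; lra.
    + intros t; auto_derive; auto.
    + apply g_ge_peak. }
assert (Is : 64 / 10000 * s ^ 3 <= RInt g s (13 / 10 * s)).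
{ set (L := fun t => 54 / 10000 * t ^ 3).
  apply Rle_trans with (L (13 / 10 * s) - L s).
  - assert (0 < s ^ 3) by (apply pow_lt; auto).
    replace (L (13 / 10 * s) - L s) with (54 / 10000 * (1197 / 1000) * s ^ 3)
      by (unfold L; field); lra.
  - apply (RInt_ge_antiderivative g (fun t => 162 / 10000 * t ^ 2)); auto using g_continuous.
    + lra.
    + intros t; unfold L; auto_derive; auto; field.
    + intros t; auto_derive; auto.
    + apply g_ge_slope. }
assert (I2 : 0 <= RInt g (13 / 10 * s) (81 / 50 * s)).
{ apply RInt_ge_0; auto; [lra|]; intros t ht; apply g_nonneg; lra. }
assert (I3 : - (430 / 10000 * s ^ 3) <= RInt g (81 / 50 * s) (b / 2)).
{ set (e := fun t => exp (- (99 / 100 * (t / s) ^ 2))).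
  set (L := fun t => 101 / 324 / s * (s ^ 2 / (198 / 100) * ((t ^ 2 + s ^ 2 / (99 / 100)) * e t))).
  apply Rle_trans with (L (b / 2) - L (81 / 50 * s)).
  - assert (0 <= L (b / 2)).
    { unfold L, e; apply Rmult_le_pos; [left; apply Rdiv_lt_0_compat; lra|].
      apply Rmult_le_pos; [nra|].
      apply Rmult_le_pos; [|left; apply exp_pos].
      generalize (pow2_ge_0 (b / 2)) (pow2_ge_0 s); lra. }
    enough (L (81 / 50 * s) <= 430 / 10000 * s ^ 3) by lra.
    assert (he : e (81 / 50 * s) <= 3 / 40).
    { unfold e; replace (81 / 50 * s / s) with (81 / 50) by (field; lra).
      apply exp_shoulder. }
    assert (h3 : 0 < s ^ 3) by (apply pow_lt; auto).
    replace (L (81 / 50 * s)) with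
      (101 / 324 * (100 / 198) * ((81 / 50) ^ 2 + 100 / 99) * s ^ 3 * e (81 / 50 * s))
      by (unfold L; field; lra).
    apply Rle_trans with (101 / 324 * (100 / 198) * ((81 / 50) ^ 2 + 100 / 99) * s ^ 3 * (3 / 40)).
    + apply Rmult_le_compat_l; lra.
    + lra.
  - apply (RInt_ge_antiderivative g (fun t => - (101 / 324 / s * (t ^ 3 * e t))));
      auto using g_continuous.
    + lra.
    + intros t; unfold L, e; auto_derive; auto.
      replace (t * / s * (t * / s * 1)) with ((t / s) ^ 2) by (field; lra); field; lra.
    + intros t; unfold e; auto_derive; auto.
    + apply g_ge_shoulder. }
set (q := exp (- (1235 / 10000 * (K / b)))).
assert (hq : 0 < q <= 20 / 41 / (K / b)) by (split; [apply exp_pos|apply exp_outer; auto]).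
assert (hbs : b = s * r) by (unfold s; field; lra).
(* In the unit [s ^ 3] the integral of [t ^ 2] up to multiples of [b = s r] costs [r ^ 3], which the
   exponential must beat; [A] bounds their product. *)
assert (F : forall c d e A, 0 <= c <= 7 / 10 -> c <= e <= 2 -> 0 <= d ->
  d * (1 + 1 / 125 + c ^ 2) <= 5 / 4 * (c ^ 2 * (1 - 1 / 300)) ->
  exp (- (d * (K / b))) * r ^ 3 <= A ->
  - (101 / 600 * (e ^ 3 - c ^ 3) * A * s ^ 3) <= RInt g (c * b) (e * b)).
{ intros c d e A hc he hd hcd hA.
  set (X := exp (- (d * (K / b)))) in *.
  set (L := fun t => - (101 / 600 * X * t ^ 3)).
  apply Rle_trans with (L (e * b) - L (c * b)).
  - replace (L (e * b) - L (c * b)) with (- (101 / 600 * (e ^ 3 - c ^ 3) * (X * r ^ 3) * s ^ 3))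
      by (unfold L; rewrite hbs; field).
    apply Ropp_le_contravar, Rmult_le_compat_r; [left; apply pow_lt; auto|].
    apply Rmult_le_compat_l; auto.
    assert (c ^ 3 <= e ^ 3) by (apply pow_incr; lra); lra.
  - apply (RInt_ge_antiderivative g (fun t => - (101 / 200 * X * t ^ 2))); auto using g_continuous.
    + nra.
    + intros t; unfold L; auto_derive; auto; field.
    + intros t; auto_derive; auto.
    + intros t ht; apply (g_ge_flank c); auto; split; [lra|]; nra. }
assert (hqr : q <= 20 / 41 / r ^ 2) by (rewrite r_sq; lra).
assert (hir : / r <= / 6) by (apply Rinv_le_contravar; lra).
assert (hr3 : 0 < r ^ 3) by (apply pow_lt; lra).
assert (I4 : - (15 / 10000 * s ^ 3) <= RInt g (b / 2) (7 / 10 * b)).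
{ assert (h1 : exp (- (247 / 1000 * (K / b))) * r ^ 3 <= 400 / 1681 / 6).
  { replace (exp (- (247 / 1000 * (K / b)))) with (q ^ 2)
      by (unfold q; rewrite <- exp_mult_nat; f_equal; simpl; lra).
    assert (h2 : q ^ 2 <= (20 / 41 / r ^ 2) ^ 2) by (apply pow_incr; lra).
    apply Rle_trans with ((20 / 41 / r ^ 2) ^ 2 * r ^ 3); [apply Rmult_le_compat_r; lra|].
    replace ((20 / 41 / r ^ 2) ^ 2 * r ^ 3) with (400 / 1681 * / r) by (field; lra); lra. }
  assert (h2 := F (1 / 2) (247 / 1000) (7 / 10) _ ltac:(lra) ltac:(lra) ltac:(lra) ltac:(lra) h1).
  replace (b / 2) with (1 / 2 * b) by field.
  assert (0 < s ^ 3) by (apply pow_lt; auto); lra. }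
assert (I4' : - (8 / 10000 * s ^ 3) <= RInt g (7 / 10 * b) (2 * b)).
{ assert (h1 : exp (- (4 / 10 * (K / b))) * r ^ 3 <= 8000 / 68921 / 216).
  { apply Rle_trans with (q ^ 3 * r ^ 3).
    - apply Rmult_le_compat_r; [lra|].
      unfold q; rewrite <- exp_mult_nat; apply exp_le; simpl; lra.
    - assert (h2 : q ^ 3 <= (20 / 41 / r ^ 2) ^ 3) by (apply pow_incr; lra).
      apply Rle_trans with ((20 / 41 / r ^ 2) ^ 3 * r ^ 3); [apply Rmult_le_compat_r; lra|].
      replace ((20 / 41 / r ^ 2) ^ 3 * r ^ 3) with (8000 / 68921 * (/ r) ^ 3) by (field; lra).
      assert ((/ r) ^ 3 <= (/ 6) ^ 3); [|lra].
      apply pow_incr; split; [left; apply Rinv_0_lt_compat|]; lra. }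
  assert (h2 := F (7 / 10) (4 / 10) 2 _ ltac:(lra) ltac:(lra) ltac:(lra) ltac:(lra) h1).
  assert (0 < s ^ 3) by (apply pow_lt; auto); lra. }
assert (I5 : - (1 / 1000 * s ^ 3) <= RInt g (2 * b) PI).
{ set (A := exp (- (79 / 100 * (K / b)))).
  assert (eA : A <= q ^ 6).
  { unfold A, q; rewrite <- exp_mult_nat; apply exp_le; simpl; lra. }
  set (L := fun t => - (202 / 100 * A * t)).
  assert (h0 : 0 < A) by apply exp_pos.
  assert (hpi4 := PI_4).
  apply Rle_trans with (L PI - L (2 * b)).
  - unfold L; apply Rle_trans with (- (202 / 100 * A * 4)); [|nra].
    apply Ropp_le_contravar.
    assert (h1 : q ^ 6 <= (20 / 41 / r ^ 2) ^ 6) by (apply pow_incr; lra).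
    assert (es : s = K / r ^ 3).
    { assert (e := r_sq); replace K with (r ^ 2 * b) by (rewrite e; field; lra).
      unfold s; field; lra. }
    (* The length of this interval does not shrink with [s], so [s] itself is bounded below, by
       [s = K / r ^ 3] and [3 <= K]; meanwhile [q ^ 6] is of order [r ^ (-12)]. *)
    assert (hs3 : 27 / r ^ 9 <= s ^ 3).
    { replace (27 / r ^ 9) with ((3 / r ^ 3) ^ 3) by (field; lra); rewrite es.
      apply pow_incr; split; [apply Rdiv_le_0_compat; [lra|apply pow_lt; lra]|].
      apply Rmult_le_compat_r; [left; apply Rinv_0_lt_compat, pow_lt; lra|auto]. }
    assert (h9 : 0 < / r ^ 9) by (apply Rinv_0_lt_compat, pow_lt; lra).
    apply Rle_trans with (1 / 1000 * (27 / r ^ 9)); [|lra].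
    assert (h2 : (20 / 41 / r ^ 2) ^ 6 = (20 / 41) ^ 6 * / r ^ 9 * / r ^ 3) by (field; lra).
    assert (h3 : / r ^ 3 <= / 216).
    { apply Rinv_le_contravar; [lra|]; apply Rle_trans with (6 ^ 3); [lra|apply pow_incr; lra]. }
    assert (h4 : (20 / 41) ^ 6 * / r ^ 9 * / r ^ 3 <= (20 / 41) ^ 6 * / r ^ 9 * / 216)
      by (apply Rmult_le_compat_l; lra).
    lra.
  - apply (RInt_ge_antiderivative g (fun t => - (202 / 100 * A))); auto using g_continuous.
    + lra.
    + intros t; unfold L; auto_derive; auto; field; lra.
    + intros t; auto_derive; auto.
    + apply g_ge_minor. }
assert (0 < s ^ 3) by (apply pow_lt; auto).
lra.
Qed.

End Zones.

(** * The saddle point *)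

(** The saddle point depends on [M]. Monotonicity lets [M] be chosen first, from a lower bound of
    [b] that is independent of [M]. *)
Lemma tail_anti (b c : R) (M : nat) : 0 < b <= c -> tail c M <= tail b M.
Proof.
intros h; assert (h1 := exp_opp_lt1 b ltac:(lra)); assert (h2 := exp_opp_lt1 c ltac:(lra)).
assert (h3 : exp (- c) <= exp (- b)) by (apply exp_le; lra).
unfold tail; apply Rmult_le_compat.
- apply Rmult_le_pos; [lra|apply pow_le; lra].
- left; apply Rinv_0_lt_compat; nra.
- apply Rmult_le_compat_l; [lra|apply pow_incr; lra].
- apply Rinv_le_contravar; [nra|apply pow_incr; lra].
Qed.

Lemma tail_vanishes (b eps : R) : 0 < b -> 0 < eps ->
  exists M0, forall M, (M0 <= M)%nat -> tail b M <= eps.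
Proof.
intros hb he; assert (hq := exp_opp_lt1 b hb); set (q := exp (- b)) in *.
assert (hl := is_lim_seq_geom q ltac:(rewrite Rabs_pos_eq; lra)).
assert (he' : 0 < eps * (1 - q) ^ 2 / 3) by (apply Rdiv_lt_0_compat; [apply Rmult_lt_0_compat; nra|lra]).
apply is_lim_seq_spec in hl; destruct (hl (mkposreal _ he')) as [N hN]; simpl in hN.
exists N; intros M hM; specialize (hN (S M) ltac:(lia)).
rewrite Rminus_0_r in hN; assert (hp : 0 <= q ^ S M) by (apply pow_le; lra).
rewrite Rabs_pos_eq in hN by auto.
unfold tail; fold q; apply (Rmult_le_reg_r ((1 - q) ^ 2)); [nra|].
unfold Rdiv at 1; rewrite Rmult_assoc, Rinv_l by nra.
simpl in hN |- *; lra.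
Qed.

Definition mean (b : R) (M : nat) : R := lsum (fun m => INR m * (wt b m / (1 - wt b m))) (seq 1 M).

Lemma mean_continuous (b : R) (M : nat) : 0 < b -> continuity_pt (fun x => mean x M) b.
Proof.
intros hb; unfold mean.
assert (H : forall l, pos_parts l ->
  continuity_pt (fun x => lsum (fun m => INR m * (wt x m / (1 - wt x m))) l) b).
{ induction 1 as [|m l hm _ IH].
  - apply continuity_pt_const; intros x y; reflexivity.
  - apply (continuity_pt_plus (fun x => INR m * (wt x m / (1 - wt x m)))); auto.
    assert (hw := wt_bounds b m hb hm).
    apply derivable_continuous_pt, ex_derive_Reals_0; unfold wt in *; auto_derive; lra. }
apply H; apply List.Forall_forall; intros m hm; apply in_seq in hm; lia.
Qed.

(** Intermediate value theorem. At the lower end the part 1 alone gives a mean of at least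
    [K (1 / b - 1) = 2 n - K > n]; at the upper end [mean_sum_le] gives at most [2160 / K < n]. *)
Lemma saddle_point (k n M : nat) (K := INR k) : 3 <= K -> (1 <= M)%nat ->
  2160 < K * INR n -> K < INR n ->
  exists b, K / (2 * INR n) <= b <= K / 36 /\ K * mean b M = INR n.
Proof.
intros hk hM hkn hlt.
set (N := INR n) in *; assert (hN : 0 < N) by lra.
assert (hlo : 0 < K / (2 * N)) by (apply Rdiv_lt_0_compat; lra).
assert (hlh : K / (2 * N) < K / 36).
{ apply Rmult_lt_compat_l; [lra|]; apply Rinv_lt_contravar; [lra|].
  destruct (Rle_lt_dec N 18); [nra|lra]. }
destruct (Ranalysis5.IVT_interv (fun x => N - K * mean x M) (K / (2 * N)) (K / 36)) as [b [hb e]].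
- intros x hx; apply continuity_pt_minus; [apply continuity_pt_const; intros ? ?; reflexivity|].
  apply continuity_pt_mult; [apply continuity_pt_const; intros ? ?; reflexivity|].
  apply mean_continuous; lra.
- auto.
- set (b := K / (2 * N)) in *.
  assert (hb1 : b < 1 / 2).
  { unfold b; apply (Rmult_lt_reg_r (2 * N)); [lra|].
    unfold Rdiv at 1; rewrite Rmult_assoc, Rinv_l; lra. }
  assert (hbN : 2 * N * b = K) by (unfold b; field; lra).
  assert (hq := exp_opp_lt1 b hlo).
  assert (h1 : exp (- b) / (1 - exp (- b)) <= mean b M).
  { unfold mean; destruct M as [|M]; [lia|]; simpl seq; rewrite lsum_cons.
    assert (0 <= lsum (fun m => INR m * (wt b m / (1 - wt b m))) (seq 2 M)).
    { assert (H : forall l, pos_parts l -> 0 <= lsum (fun m => INR m * (wt b m / (1 - wt b m))) l).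
      { induction 1 as [|m l hm _ IH]; [simpl; lra|]; rewrite lsum_cons.
        assert (hw := wt_bounds b m hlo hm).
        apply Rplus_le_le_0_compat; auto; apply Rmult_le_pos; [apply pos_INR|].
        apply Rdiv_le_0_compat; lra. }
      apply H; apply List.Forall_forall; intros m hm; apply in_seq in hm; lia. }
    unfold wt at 1 2; simpl INR; rewrite !Rmult_1_l; lra. }
  assert (h2 : exp (- b) / (1 - exp (- b)) = / (1 - exp (- b)) - 1) by (field; lra).
  assert (h3 : / b <= / (1 - exp (- b))).
  { apply Rinv_le_contravar; [lra|]; generalize (exp_ineq1_le (- b)); lra. }
  assert (h4 : K * (/ b - 1) <= K * mean b M) by (apply Rmult_le_compat_l; lra).
  replace (K * (/ b - 1)) with (2 * N - K) in h4 by (rewrite <- hbN; field; lra).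
  lra.
- set (b := K / 36) in *; assert (hb0 : 0 < b) by (unfold b; lra).
  assert (h := mean_sum_le b M hb0); fold (mean b M) in h.
  assert (h1 : K * mean b M <= K * (5 / 3 / b ^ 2)) by (apply Rmult_le_compat_l; lra).
  replace (K * (5 / 3 / b ^ 2)) with (2160 / K) in h1 by (unfold b; field; lra).
  assert (2160 / K < N); [|lra].
  apply (Rmult_lt_reg_r K); [lra|]; unfold Rdiv; rewrite Rmult_assoc, Rinv_l; lra.
- exists b; split; [auto|lra].
Qed.

Theorem log_concave_large (cf : list nat -> nat -> nat) (k n : nat) :
  (forall j, cf [] j = if Nat.eqb j 0 then 1%nat else 0%nat) ->
  (forall m ms j, (1 <= m)%nat ->
     cf (m :: ms) j = (cf ms j + if Nat.leb m j then cf (m :: ms) (j - m) else 0)%nat) ->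
  (3 <= k <= 5)%nat -> (36 * 60 < k * n)%nat ->
  exists M0, forall M, (M0 <= M)%nat ->
    (cf (parts k M) (n - 1) * cf (parts k M) (n + 1) < cf (parts k M) n * cf (parts k M) n)%nat.
Proof.
intros h0 h1 hk hkn.
assert (hk3 : 3 <= INR k) by (replace 3 with (INR 3) by (simpl; lra); apply le_INR; lia).
assert (hk5 : INR k <= 5) by (replace 5 with (INR 5) by (simpl; lra); apply le_INR; lia).
assert (hkn' : 2160 < INR k * INR n).
{ rewrite <- mult_INR; replace 2160 with (INR (36 * 60)) by (rewrite mult_INR; simpl; lra).
  apply lt_INR; auto. }
assert (hn : INR k < INR n) by (apply lt_INR; nia).
set (lo := INR k / (2 * INR n)).
assert (hlo : 0 < lo) by (apply Rdiv_lt_0_compat; lra).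
(* [5 * (1 + 1 / 2) / 1500 = 1 / 200], the tail allowed in [integral_gt0]. *)
destruct (tail_vanishes lo (1 / 1500) hlo ltac:(lra)) as [M0 hM0].
exists (S M0); intros M hM.
destruct (saddle_point k n M hk3 ltac:(lia) hkn' hn) as [b [hb e]]; fold lo in hb.
apply (log_concave_of_integral cf h0 h1 b).
- lra.
- apply pos_parts_parts.
- nia.
- apply integral_gt0; auto.
  + lra.
  + replace 36 with (INR k / (INR k / 36)) by (field; lra).
    apply Rmult_le_compat_l; [lra|]; apply Rinv_le_contravar; lra.
  + rewrite lsum_parts; exact e.
  + assert (t1 := tail_anti lo b M ltac:(lra)); assert (t2 := tail_anti lo (2 * b) M ltac:(lra)).
    assert (t3 := hM0 M ltac:(lia)).
    assert (0 <= tail b M + tail (2 * b) M / 2).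
    { assert (T := tail_nonneg M).
      assert (T1 := T b ltac:(lra)); assert (T2 := T (2 * b) ltac:(lra)); lra. }
    nra.
Qed.

End Analytic.

Import Analytic.
From Stdlib Require Import NArith.
From mathcomp Require Import all_boot all_algebra.
From mathcomp Require Import zify ring.

Set Implicit Arguments.
Unset Strict Implicit.
Unset Printing Implicit Defensive.

Import GRing.Theory Num.Theory.

(** * Coloured partitions as coefficients *)

Fixpoint cnt (ms : seq nat) (j : nat) : nat :=
  if ms is m :: ms' then \sum_(i < j.+1 | i * m <= j) cnt ms' (j - i * m) else j == 0.

Lemma cnt_widen m (F : nat -> nat) j N : 0 < m -> j <= N ->
  \sum_(i < N.+1 | i * m <= j) F i = \sum_(i < j.+1 | i * m <= j) F i.
Proof.
move=> m0 jN; rewrite [RHS](big_ord_widen_cond N.+1 (fun i => i * m <= j) F) //.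
apply: eq_bigl => i; case h: (_ * _ <= _) => //=; apply/esym.
by rewrite ltnS (leq_trans _ h) ?leq_pmulr.
Qed.

Lemma cnt_cons m ms j : 0 < m ->
  cnt (m :: ms) j = cnt ms j + (if m <= j then cnt (m :: ms) (j - m) else 0).
Proof.
move=> m0 /=; rewrite big_mkcond big_ord_recl mul0n leq0n subn0; congr (_ + _).
rewrite -(big_mkcond (fun i : 'I_j => bump 0 i * m <= j) (fun i : 'I_j => cnt ms (j - bump 0 i * m))).
case: leqP => [mj|jm]; last first.
  rewrite big_pred0 // => i; rewrite /bump /= add1n mulSn.
  by apply/negbTE; rewrite -ltnNge (leq_trans jm) ?leq_addr.
case: j mj => [|j] mj; first by rewrite leqn0 in mj; rewrite (eqP mj) in m0.
have jj : j.+1 - m <= j by lia.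
rewrite -(@cnt_widen m (fun i => cnt ms (j.+1 - m - i * m)) _ j m0 jj).
apply: eq_big => i; first by rewrite /bump /= add1n mulSn; lia.
by rewrite /bump /= add1n mulSn subnDA.
Qed.

(** The series [1 / (1 - X^m)], cut so that coefficients up to degree [N] are exact for [m > 0].
    Commutativity of the product then makes the count independent of the order of the parts. *)
Definition geo (N m : nat) : {poly int} := (\sum_(i < N.+1) 'X^(i * m))%R.
Definition gen (N : nat) (ms : seq nat) : {poly int} := (\prod_(m <- ms) geo N m)%R.

Lemma coef_gen N ms j : all (leq 1) ms -> j <= N -> ((gen N ms)`_j = (cnt ms j)%:R :> int)%R.
Proof.
elim: ms j => [|m ms IH] j.
  by rewrite /gen big_nil coef1.
case/andP => m0 hms jN; rewrite /gen big_cons mulr_suml coef_sum /=.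
rewrite -(@cnt_widen m (fun i => cnt ms (j - i * m)) j N m0 jN) natr_sum [RHS]big_mkcond /=.
apply: eq_bigr => i _; rewrite coefXnM ltnNge; case: leqP => //= h.
by rewrite -IH //; lia.
Qed.

Lemma cnt_perm s t j : all (leq 1) s -> perm_eq s t -> cnt s j = cnt t j.
Proof.
move=> hs st; have ht : all (leq 1) t by rewrite -(perm_all _ st).
apply/eqP; rewrite -(eqr_nat int) -!(@coef_gen j) //.
by rewrite /gen (perm_big _ st).
Qed.

Lemma cnt_skip s t j : all (ltn j) s -> cnt (s ++ t) j = cnt t j.
Proof.
elim: s => //= m s IH /andP[jm hs]; rewrite -IH // -/(cnt (m :: s ++ t) j) cnt_cons; last by lia.
by rewrite leqNgt jm addn0.
Qed.

Lemma parts_flatten k M : parts k M = flatten (nseq k (iota 1 M)).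
Proof.
have e a : List.seq a M = iota a M by elim: M a => //= M IH a; rewrite IH.
by elim: k => //= k IH; rewrite -IH /parts /= e.
Qed.

Lemma parts_pos k M : all (leq 1) (parts k M).
Proof.
rewrite parts_flatten; elim: k => //= k IH; rewrite all_cat IH andbT.
by apply/allP => m; rewrite mem_iota => /andP[].
Qed.

Lemma gen_parts N k M : (gen N (parts k M) = (\prod_(1 <= m < M.+1) geo N m) ^+ k)%R.
Proof.
rewrite parts_flatten /gen; elim: k => [|k IH]; first by rewrite big_nil expr0.
by rewrite /= big_cat IH exprS /index_iota subSS subn0.
Qed.

Lemma cnt_parts_extend k n M j : j <= n -> n <= M -> cnt (parts k M) j = cnt (parts k n) j.
Proof.
move=> jn nM; pose t := flatten (nseq k (iota n.+1 (M - n))).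
have ht : all (ltn j) t.
  rewrite /t; elim: (k) => //= k' IH; rewrite all_cat IH andbT.
  by apply/allP => m; rewrite mem_iota => /andP[h _] /=; apply: leq_ltn_trans h.
rewrite -(@cnt_skip t (parts k n) j) //; apply: cnt_perm; first exact: parts_pos.
rewrite !parts_flatten; apply/permP => p; rewrite count_cat /t !count_flatten !map_nseq !sumn_nseq.
have -> : iota 1 M = iota 1 n ++ iota n.+1 (M - n) by have := iotaD 1 n (M - n); rewrite subnKC.
by rewrite count_cat mulnDl addnC.
Qed.

(** Distributing the product of the [geo] over pairs (part, colour) gives one monomial per
    multiplicity function, of degree the sum of its parts. *)
Lemma nb_cnt k n : nb_colored_partitions k n = cnt (parts k n) n.
Proof.
apply/eqP; rewrite -(eqr_nat int) -(@coef_gen n) ?parts_pos // gen_parts.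
rewrite big_add1 /= big_mkord -prodrXl.
have -> : (\prod_(i < n) geo n i.+1 ^+ k = \prod_(p : 'I_n * 'I_k) geo n p.1.+1)%R.
  rewrite -(pair_bigA _ (fun (i : 'I_n) (c : 'I_k) => geo n i.+1)) /=.
  by apply: eq_bigr => i _; rewrite prodr_const card_ord.
rewrite /geo bigA_distr_bigA coef_sum /= /nb_colored_partitions -sum1_card natr_sum.
rewrite big_mkcond /=; apply/eqP; apply: eq_bigr => f _.
rewrite -expr_sum coefXn inE eq_sym.
rewrite (eq_bigr (fun p : 'I_n * 'I_k => p.1.+1 * f p)) => [|p _]; last exact: mulnC.
by case: eqP.
Qed.

Lemma nb_cnt_parts k j M : j <= M -> nb_colored_partitions k j = cnt (parts k M) j.
Proof. by move=> jM; rewrite nb_cnt (cnt_parts_extend _ (leqnn j) jM). Qed.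

Lemma nb_convolution k l n : nb_colored_partitions (k + l) n =
  \sum_(i < n.+1) nb_colored_partitions k i * nb_colored_partitions l (n - i).
Proof.
apply/eqP; rewrite -(eqr_nat int) nb_cnt -(@coef_gen n) ?parts_pos // gen_parts exprD.
rewrite coefM natr_sum; apply/eqP/eq_bigr => i _.
have hi : i <= n by have := ltn_ord i; rewrite ltnS.
rewrite natrM (nb_cnt_parts k hi) (nb_cnt_parts l (leq_subr i n)).
rewrite -(coef_gen (parts_pos k n) hi) -(coef_gen (parts_pos l n) (leq_subr i n)).
by rewrite !gen_parts.
Qed.

Lemma cnt0 ms : all (leq 1) ms -> cnt ms 0 = 1.
Proof. by elim: ms => //= m ms IH /andP[_ /IH e]; rewrite big_mkcond big_ord1 mul0n /= e. Qed.

Lemma nb_gt0 k n : 0 < k -> 0 < nb_colored_partitions k n.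
Proof.
move=> k0; rewrite (@nb_cnt_parts k n n.+1) //; case: k k0 => // k _.
have := parts_pos k.+1 n.+1.
have -> : parts k.+1 n.+1 = 1 :: (iota 2 n ++ parts k n.+1) by rewrite !parts_flatten.
move: (iota 2 n ++ _) => ms /andP[_ hms]; elim: n => [|n IH]; rewrite cnt_cons //.
  by rewrite cnt0.
by rewrite subSS subn0; rewrite ltn_addl.
Qed.

(** * Convolution *)

(** The ratios of consecutive terms decrease; cross-multiplied, this says which [2 x 2] minors are
    nonnegative. *)
Lemma log_concave_le (a : nat -> nat) i j : (forall n, 0 < a n) ->
  (forall n, a n * a n.+2 <= a n.+1 ^ 2) -> i <= j -> a i * a j.+1 <= a i.+1 * a j.
Proof.
move=> a0 lc; elim: j => [|j IH].
  by rewrite leqn0 => /eqP ->; rewrite mulnC.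
rewrite leq_eqVlt => /predU1P[->|]; first by rewrite mulnC.
rewrite ltnS => /IH h; rewrite -(leq_pmul2r (a0 j)).
have h1 := lc j; have h2 : a i * (a j * a j.+2) <= a i * a j.+1 ^ 2 by rewrite leq_mul2l h1 orbT.
have h3 : a j.+1 * (a i * a j.+1) <= a j.+1 * (a i.+1 * a j) by rewrite leq_mul2l h orbT.
by nia.
Qed.

(** Summing over ordered pairs counts each product of minors twice, hence the factor 2; no order on
    [I] is involved. *)
Lemma binet_cauchy2 (R : comRingType) (I : finType) (A A' B B' : I -> R) :
  ((\sum_x \sum_y (A x * A' y - A y * A' x) * (B x * B' y - B y * B' x)) =
   ((\sum_x A x * B x) * (\sum_x A' x * B' x) - (\sum_x A x * B' x) * (\sum_x A' x * B x)) *+ 2)%R.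
Proof.
have D (f g : I -> R) : (\sum_x \sum_y f x * g y = (\sum_x f x) * (\sum_x g x))%R
  by rewrite big_distrlr.
transitivity ((\sum_x \sum_y (A x * B x) * (A' y * B' y)
    - \sum_x \sum_y (A x * B' x) * (A' y * B y))
  + (\sum_x \sum_y (A' x * B' x) * (A y * B y)
    - \sum_x \sum_y (A' x * B x) * (A y * B' y)))%R.
  rewrite -!sumrB -big_split /=; apply: eq_bigr => x _.
  by rewrite -!sumrB -big_split /=; apply: eq_bigr => y _; ring.
by rewrite !D; ring.
Qed.

Lemma log_concave_convolution (a b c : nat -> nat) n :
  (forall j, 0 < a j) -> (forall j, 0 < b j) ->
  (forall j, a j * a j.+2 <= a j.+1 ^ 2) -> (forall j, b j * b j.+2 <= b j.+1 ^ 2) ->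
  (forall j, c j = \sum_(i < j.+1) a i * b (j - i)) ->
  c n * c n.+2 < c n.+1 ^ 2.
Proof.
move=> a0 b0 la lb hc.
(* Shifted copies of [a] and [b], extended by 0, whose pairings are [c n], [c n.+1] (twice) and
   [c n.+2]. *)
pose A (x : 'I_n.+3) : int := (if x <= n.+1 then a (n.+1 - x) else 0)%N.
pose A' (x : 'I_n.+3) : int := a (n.+2 - x).
pose B (x : 'I_n.+3) : int := b x.
pose B' (x : 'I_n.+3) : int := (if 0 < x then b x.-1 else 0)%N.
have ce j : ((c j)%:Z = \sum_(i < j.+1) (a (j - i)%N)%:Z * (b i)%:Z)%R.
  rewrite hc -natz natr_sum (reindex_inj rev_ord_inj) /=; apply: eq_bigr => i _.
  have hi : i <= j by rewrite -ltnS.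
  by rewrite !subSS subKn // natrM !natz.
have AB : (\sum_x A x * B x = (c n.+1)%:Z)%R.
  rewrite ce big_ord_recr /= {2}/A /= ltnn mul0r addr0; apply: eq_bigr => i _.
  by rewrite /A /B /=; have -> : i <= n.+1 by have := ltn_ord i; lia.
have A'B : (\sum_x A' x * B x = (c n.+2)%:Z)%R by rewrite ce.
have A'B' : (\sum_x A' x * B' x = (c n.+1)%:Z)%R.
  by rewrite ce big_ord_recl /B' /= mulr0 add0r; apply: eq_bigr => i _.
have AB' : (\sum_x A x * B' x = (c n)%:Z)%R.
  rewrite ce big_ord_recl /B' /= mulr0 add0r big_ord_recr /= {2}/A /= /bump /= !add1n ltnn mul0r addr0.
  by apply: eq_bigr => i _; rewrite /A /= /bump /= !add1n ltn_ord subSS.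
have mA (x y : 'I_n.+3) : x < y -> (0 <= A x * A' y - A y * A' x)%R.
  move=> xy; rewrite /A /A'; have yn := ltn_ord y.
  have -> : x <= n.+1 by lia.
  case: ifP => hy; last by rewrite mul0r subr0.
  have := @log_concave_le a (n.+1 - y) (n.+1 - x) a0 la.
  by rewrite -!subSn; lia.
have mB (x y : 'I_n.+3) : x < y -> (0 <= B x * B' y - B y * B' x)%R.
  move=> xy; rewrite /B /B'; have -> : 0 < y by lia.
  case: ifP => hx; last by rewrite mulr0 subr0.
  have := @log_concave_le b x.-1 y.-1 b0 lb.
  by rewrite !prednK; lia.
have H : (0 < \sum_x \sum_y (A x * A' y - A y * A' x) * (B x * B' y - B y * B' x))%R.
  have pos (x y : 'I_n.+3) : (0 <= (A x * A' y - A y * A' x) * (B x * B' y - B y * B' x))%R.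
    case: (ltngtP x y) => [xy|yx|/val_inj ->]; last by rewrite !subrr mul0r.
      by rewrite mulr_ge0 ?mA ?mB.
    by rewrite -mulrNN !opprB mulr_ge0 ?mA ?mB.
  (* Strictness comes from the pair of extreme indices: the boundary zeros reduce its minors to
     [a n.+1 * a 0] and [b 0 * b n.+1]. *)
  rewrite (bigD1 ord0) //= (bigD1 ord_max) //=; apply: ltr_wpDr.
    by apply: sumr_ge0 => x _; apply: sumr_ge0 => y _.
  apply: ltr_wpDr; first by apply: sumr_ge0 => y _.
  rewrite /A /A' /B /B' /= ltnn !mul0r mulr0 !subr0 subnn.
  by rewrite !mulr_gt0 // ltz_nat.
move: H; rewrite binet_cauchy2 AB A'B A'B' AB' pmulrn_lgt0 // subr_gt0.
by rewrite -!PoszM ltz_nat -mulnn.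
Qed.

(** * The computed range *)

(* [upd F B a] is the list [b] with [b_j = a_j + (F ++ rev B ++ b)_j]: the pair
   [(F, B)] is a queue of the terms of [b] that are still to be added. *)
Fixpoint upd (F B a : seq N) : seq N :=
  if a is x :: a' then
    match F, rev B with
    | y :: F', _ => let z := N.add x y in z :: upd F' (z :: B) a'
    | [::], y :: F' => let z := N.add x y in z :: upd F' [:: z] a'
    | [::], [::] => a
    end
  else [::].

Lemma size_upd F B a : size (upd F B a) = size a.
Proof.
elim: a F B => //= x a IH [|y F] B /=; last by rewrite IH.
by case: (rev B) => //= y F; rewrite IH.
Qed.

Lemma nth_upd F B a j : 0 < size F + size B -> j < size a ->
  N.to_nat (nth N0 (upd F B a) j) =
  N.to_nat (nth N0 a j) + N.to_nat (nth N0 (F ++ rev B ++ upd F B a) j).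
Proof.
elim: a F B j => //= x a IH [|y F] B j /=.
  case/lastP: B => [|B y _]; first by rewrite addn0.
  rewrite rev_rcons /=; case: j => [|j] /=; first by rewrite Nnat.N2Nat.inj_add.
  by rewrite ltnS => ja; rewrite IH //= addn1.
case: j => [|j] /= _; first by rewrite Nnat.N2Nat.inj_add.
rewrite ltnS => ja; rewrite IH //=; last by rewrite addnS.
by rewrite rev_cons cat_rcons.
Qed.

(** Division of a power series by [1 - X^m]: the first [m] coefficients do not change, and they form
    the initial queue for the others. *)
Definition add_part (a : seq N) (m : nat) : seq N :=
  let f := take m a in f ++ upd f [::] (drop m a).

(* [force a k] is [k], but evaluating it first normalizes the entries of [a].
   Without it a lazy evaluation would keep all intermediate sums suspended; in
   [add_list] it is applied to a closure, so that an eager evaluation does not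
   keep all intermediate lists. *)
Fixpoint force_pos (T : Type) (p : positive) (k : T) : T :=
  match p with xH => k | xO p' | xI p' => force_pos p' k end.

Fixpoint force (T : Type) (a : seq N) (k : T) : T :=
  if a is x :: a' then
    if x is Npos p then force_pos p (force a' k) else force a' k
  else k.

Lemma forceE (T : Type) a (k : T) : force a k = k.
Proof.
have forceP p (l : T) : force_pos p l = l by elim: p.
by elim: a => //= -[|p] a IH; rewrite ?forceP.
Qed.

Fixpoint add_list (s : seq nat) (a : seq N) : seq N :=
  if s is m :: s' then
    let b := add_part a m in
    if m %% 16 == 0 then force b (fun _ : unit => add_list s' b) tt else add_list s' b
  else a.

Definition add_parts (M : nat) (a : seq N) : seq N := add_list (iota 1 M) a.

Definition represents (a : seq N) (ms : seq nat) : Prop :=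
  forall j, j < size a -> N.to_nat (nth N0 a j) = cnt ms j.

Lemma size_add_part a m : size (add_part a m) = size a.
Proof. by rewrite size_cat size_upd -size_cat cat_take_drop. Qed.

Lemma represents_add_part a m ms : 0 < m -> represents a ms ->
  represents (add_part a m) (m :: ms).
Proof.
move=> m0 ha j; rewrite size_add_part => ja.
elim/ltn_ind: j ja => j IH ja; rewrite cnt_cons //.
case: (leqP m j) => [mj|jm]; last first.
  by rewrite nth_cat size_take_min leq_min jm ja nth_take // ha // addn0.
have ms' : size (take m a) = m by rewrite size_takel // (leq_trans mj) // ltnW.
rewrite -(IH (j - m)); [|lia|lia].
rewrite {1}/add_part nth_cat ms' ltnNge mj /= nth_upd ?ms' ?addn0 //; last by rewrite size_drop; lia.
by rewrite nth_drop subnKC // ha.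
Qed.

Lemma represents_add_parts a k M : represents a (parts k M) ->
  represents (add_parts M a) (parts k.+1 M).
Proof.
have gen' s b ms : all (leq 1) s -> represents b ms -> represents (add_list s b) (catrev s ms).
  elim: s b ms => //= m s IH b ms /andP[m0 hs] hb; rewrite forceE if_same.
  by apply: IH => //; apply: represents_add_part.
have h1 : all (leq 1) (iota 1 M) by apply/allP => m; rewrite mem_iota => /andP[].
move=> /(gen' _ _ _ h1) H j /H ->; apply: cnt_perm.
  by rewrite catrevE all_cat all_rev h1 parts_pos.
by rewrite catrevE !parts_flatten /= perm_cat2r perm_rev.
Qed.

Lemma represents_take a ms n : represents a ms -> represents (take n a) ms.
Proof.
move=> ha j; rewrite size_take_min leq_min => /andP[jn ja].
by rewrite nth_take // ha.
Qed.

Fixpoint log_concaveb (a : seq N) : bool :=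
  if a is x :: ((y :: z :: _) as t) then N.ltb (N.mul x z) (N.mul y y) && log_concaveb t else true.

Lemma log_concavebP a j : log_concaveb a -> j.+2 < size a ->
  N.to_nat (nth N0 a j) * N.to_nat (nth N0 a j.+2) < N.to_nat (nth N0 a j.+1) ^ 2.
Proof.
elim: a j => // x [|y [|z a]] //= IH j /andP[/N.ltb_lt h hl].
case: j => [|j] /= ja; last by apply: IH.
by rewrite -mulnn; lia.
Qed.

Lemma size_add_parts M a : size (add_parts M a) = size a.
Proof.
rewrite /add_parts; elim: (iota 1 M) a => //= m s IH a.
by rewrite forceE if_same IH size_add_part.
Qed.

Lemma represents_one L : represents (1%num :: nseq L N0) [::].
Proof. by case=> //= j _; rewrite nth_nseq if_same. Qed.

(** The entry at 0 is dropped for three colours because [3 ^ 2 = 1 * 9]. Each table is computed from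
    a prefix of the previous one, as the range of [n] shrinks when [k] grows. *)
Definition log_concave_tables (L3 L4 L5 : nat) : bool :=
  let a3 := iter 3 (add_parts L3) (1%num :: nseq L3 N0) in
  let a4 := add_parts L3 (take L4.+1 a3) in
  let a5 := add_parts L3 (take L5.+1 a4) in
  [&& log_concaveb (behead a3), log_concaveb a4 & log_concaveb a5].

Definition log_concave_at (k n : nat) : Prop :=
  nb_colored_partitions k n.-1 * nb_colored_partitions k n.+1 < nb_colored_partitions k n ^ 2.

Lemma log_concave_of_table k M a : represents a (parts k M) -> log_concaveb a -> size a <= M.+1 ->
  forall n, n.+2 < size a -> log_concave_at k n.+1.
Proof.
move=> ra ca sa n hn; rewrite /log_concave_at !(@nb_cnt_parts _ _ M) -?ra; try lia.
exact: log_concavebP.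
Qed.

Lemma log_concave_of_tables L3 L4 L5 : log_concave_tables L3 L4 L5 -> L4 <= L3 -> L5 <= L4 ->
  [/\ forall n, n.+3 <= L3 -> log_concave_at 3 n.+2,
      forall n, n.+2 <= L4 -> log_concave_at 4 n.+1 &
      forall n, n.+2 <= L5 -> log_concave_at 5 n.+1].
Proof.
rewrite /log_concave_tables; set a3 := iter _ _ _.
have r3 : represents a3 (parts 3 L3).
  by do 3 apply: represents_add_parts; exact: represents_one.
have s3 : size a3 = L3.+1 by rewrite /a3 /= !size_add_parts /= size_nseq.
move: a3 r3 s3 => a3 r3 s3 /=; set a4 := add_parts _ _.
have r4 : represents a4 (parts 4 L3) by apply/represents_add_parts/represents_take.
move=> /and3P[c3 c4 c5] h4 h5.
have s4 : size a4 = L4.+1 by rewrite size_add_parts size_takel ?s3.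
move: a4 r4 s4 c4 c5 => a4 r4 s4 c4; set a5 := add_parts _ _ => c5.
have r5 : represents a5 (parts 5 L3) by apply/represents_add_parts/represents_take.
have s5 : size a5 = L5.+1 by rewrite size_add_parts size_takel ?s4.
split=> n hn.
- rewrite /log_concave_at !(@nb_cnt_parts _ _ L3) -?r3 ?s3; try lia.
  by have := @log_concavebP (behead a3) n c3; rewrite size_behead s3 !nth_behead; apply.
- by apply: (log_concave_of_table r4 c4); rewrite s4.
- by apply: (log_concave_of_table r5 c5); rewrite s5 ?ltnS //; lia.
Qed.

(** The bounds are [2160 / k + 1]: the inequality at [n] involves the entry at [n + 1]. *)
Lemma log_concave_tablesT : log_concave_tables 721 541 433.
Proof. vm_cast_no_check (erefl true). Qed.

Lemma log_concave_small k n : 3 <= k <= 5 -> 0 < n -> k * n <= 36 * 60 -> (k, n) <> (3, 1) ->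
  log_concave_at k n.
Proof.
have [||h3 h4 h5] := log_concave_of_tables log_concave_tablesT; [lia|lia|].
case: n => // n hk _ hkn hne.
have : k = 3 \/ k = 4 \/ k = 5 by lia.
case=> [|[]] ek; subst k.
- by case: n hkn hne => // n hkn _; apply: h3; lia.
- by apply: h4; lia.
- by apply: h5; lia.
Qed.

Lemma log_concave_3_5 k n : 3 <= k <= 5 -> 0 < n -> (k, n) <> (3, 1) ->
  log_concave_at k n.
Proof.
move=> hk hn hne; case: (leqP (k * n) (36 * 60)) => hkn; first exact: log_concave_small.
have [|m ms j hm|||M0 HM] := @log_concave_large cnt k n.
- by case.
- rewrite cnt_cons; last by lia.
  by case: leqP => h; case: PeanoNat.Nat.leb_spec => //; lia.
- by lia.
- exact/ltP.
rewrite /log_concave_at; have := HM (maxn M0 n.+1).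
rewrite (@nb_cnt_parts k n.-1 (maxn M0 n.+1)) 1?(@nb_cnt_parts k n (maxn M0 n.+1));
  rewrite 1?(@nb_cnt_parts k n.+1 (maxn M0 n.+1)); try lia.
have -> : (n - 1)%coq_nat = n.-1 by lia.
have -> : (n + 1)%coq_nat = n.+1 by lia.
by rewrite -mulnn => h; apply/ltP; apply: h; lia.
Qed.

(** * Induction on the number of colours *)

Theorem theorem1p1 (k n : nat) (hk : 3 <= k) (hn : 1 <= n)
    (hkn : (k, n) <> (3, 1)) :
  nb_colored_partitions k n ^ 2 >
    nb_colored_partitions k n.-1 * nb_colored_partitions k n.+1.
Proof.
(* Convolution turns weak log-concavity into strict, so the equality at [(3, 1)] does not propagate
   to larger [k]. *)
have weak l : 3 <= l <= 5 -> forall j,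
    nb_colored_partitions l j * nb_colored_partitions l j.+2 <= nb_colored_partitions l j.+1 ^ 2.
  move=> hl j; case: (boolP ((l, j) == (3, 0))) => [/eqP[-> ->]|/eqP hlj]; last first.
    by apply/ltnW/(@log_concave_3_5 l j.+1) => //; move=> [? ?]; apply: hlj; congr (_, _).
  (* The equality case is computed from the first three coefficients 1, 3, 9. *)
  have r : represents (iter 3 (add_parts 2) [:: 1; 0; 0]%num) (parts 3 2).
    by do 3 apply: represents_add_parts; exact: (@represents_one 2).
  by rewrite !(@nb_cnt_parts _ _ 2) // -!r.
move: n hn hkn; have [l] := ubnP k; elim: l k hk => // l IH k hk kl n hn hkn.
have [k5|k5] := leqP k 5; first by apply: log_concave_3_5 => //; rewrite hk.
have c3 : 0 < 3 by [].
have hk3 : 0 < k - 3 by lia.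
have lck j : nb_colored_partitions (k - 3) j * nb_colored_partitions (k - 3) j.+2 <=
    nb_colored_partitions (k - 3) j.+1 ^ 2.
  have [k8|k8] := leqP (k - 3) 5; first by apply: weak; lia.
  by apply/ltnW/(IH (k - 3) _ _ j.+1); try lia; case; lia.
case: n hn hkn => // n _ _.
apply: (@log_concave_convolution (nb_colored_partitions 3) (nb_colored_partitions (k - 3))).
- by move=> j; apply: nb_gt0.
- by move=> j; apply: nb_gt0.
- exact: weak.
- exact: lck.
- by move=> j; rewrite -nb_convolution subnKC.
Qed.
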